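(* Let $p,q\ge1$ be relatively prime integers and $n=p+q$. For each $a\in\mathbb{Z}$: (i) the algebraic function $\zeta\mapsto\mathcal{F}_{p,q}^{(q;0)}(a;\zeta)$ is uniformized by $\mathcal{C}_{p,q}^{(q;\mathrm{symm.})}$; (ii) the algebraic function $\zeta\mapsto\mathcal{F}_{p,q}^{(n;0)}(a;\zeta^{-1})$ is uniformized by $\mathcal{C}_{p,q}^{(n;\mathrm{symm.})}$.
   Context: Hypergeometric functions: $$\mathcal{F}_{p,q}^{(q;0)}(a;\zeta)={}_nF_{n-1}\left(\begin{array}{l}\frac{a}n,\dots,\frac{a+(n-1)}n\\ \frac{a+1}p,\dots,\frac{a+p}p;\ \frac1q,\dots,\frac{q-1}q\end{array}\mid\zeta\right),\quad \mathcal{F}_{p,q}^{(n;0)}(a;\zeta)={}_nF_{n-1}\left(\begin{array}{l}\frac{-a}p,\dots,\frac{-a+(p-1)}p;\ \frac{a}q,\dots,\frac{a+(q-1)}q\\ \frac1n,\dots,\frac{n-1}n\end{array}\mid\zeta\right),$$ power series near $0$; if (in the first) a lower parameter is a non-positive integer $-m$ and an upper parameter is an integer $-m'$ with $-m\le-m'\le0$, the function is defined as the limit of $\mathcal{F}_{p,q}^{(q;0)}(a';\zeta)$ as $a'\to a$. Schwarz curves (over $\mathbb{C}$): for $2\le k\le n$, $\mathcal{C}^{(k)}_{p,q}\subset\mathbb{P}^{k-1}$ is the irreducible curve that is the closure of the set of all $[x_1:\ldots:x_k]$ such that $x_1,\dots,x_k$ (not all zero) are $k$ of the $n$ roots (with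 multiplicity) of some trinomial $x^n-g\,x^p-\beta$, $g,\beta\in\mathbb{C}$ not both zero. The symmetric group $\mathfrak{S}_k$ acts on it by permuting coordinates. The function $\zeta=(-1)^q\frac{n^n}{p^pq^q}\frac{\beta^q}{g^n}$ belongs to its function field and is $\mathfrak{S}_k$-invariant, and gives a covering $\mathcal{C}^{(k)}_{p,q}\to\mathbb{P}^1_\zeta$. The quotient $\mathcal{C}_{p,q}^{(k;\mathrm{symm.})}=\mathcal{C}_{p,q}^{(k)}/\mathfrak{S}_k$ is the curve (up to birational equivalence) whose function field is the subfield of $\mathfrak{S}_k$-invariant functions; it covers $\mathbb{P}^1_\zeta$. For $k=1$, $\mathcal{C}_{p,q}^{(1;\mathrm{symm.})}=\mathcal{C}_{p,q}^{(1)}=\mathbb{P}^1_s$ with covering $\zeta=(-1)^q\frac{n^n}{p^pq^q}\frac{s^q}{(1-s)^n}$. An algebraic function $F$ of $\zeta$ is uniformized by a curve $X$ covering $\mathbb{P}^1_\zeta$ if it becomes single-valued on $X$: there is an element of the function field of $X$ that agrees with $F(\zeta)$ near a suitable point of $X$ lying over the base point of the expansion ($\zeta=0$ in (i), $\zeta=\infty$ in (ii)). *)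

(* Defs.v *)
From HB Require Import structures.
From mathcomp Require Import all_boot all_order all_algebra.
From mathcomp Require Import fingroup perm.
From mathcomp Require Import complex.
From mathcomp Require mpoly.
From mathcomp Require Import all_classical all_reals all_analysis.

Set Implicit Arguments.
Unset Strict Implicit.
Unset Printing Implicit Defensive.

Import Order.TTheory GRing.Theory Num.Theory.
Import numFieldNormedType.Exports.

Local Open Scope classical_set_scope.
Local Open Scope ring_scope.

(* R[i] packed as a numClosedFieldType, so that it receives the norm topology
   that MathComp-Analysis attaches to number fields. *)
Definition cplx (R : realType) : numClosedFieldType := R[i].

Section Hypergeometric.
Variable R : realType.
Local Notation C := (cplx R).

Definition pochhammer (u : C) (k : nat) : C := \prod_(j < k) (u + j%:R).

Definition hypergeometric (us ls : seq C) (z : C) : C :=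
  limn (series (fun k : nat =>
    (\prod_(u <- us) pochhammer u k)
      / ((\prod_(l <- ls) pochhammer l k) * (k`!)%:R) * z ^+ k)).

Variables p q : nat.

Definition upper_q (a : C) : seq C :=
  [seq (a + j%:R) / (p + q)%:R | j <- iota 0 (p + q)].

Definition lower_q (a : C) : seq C :=
  [seq (a + j%:R) / p%:R | j <- iota 1 p] ++
  [seq j%:R / q%:R | j <- iota 1 q.-1].

Definition degenerate_q (a : C) : Prop :=
  exists m m' : nat,
    [/\ (m' <= m)%N, - m%:R \in lower_q a & - m'%:R \in upper_q a].

(* F_{p,q}^{(q;0)}(a; z) *)
Definition hyperF_q (a z : C) : C :=
  if `[< degenerate_q a >]
  then lim (hypergeometric (upper_q a') (lower_q a') z @[a' --> a^'])
  else hypergeometric (upper_q a) (lower_q a) z.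

(* F_{p,q}^{(n;0)}(a; z) *)
Definition hyperF_n (a z : C) : C :=
  hypergeometric
    ([seq (- a + j%:R) / p%:R | j <- iota 0 p] ++
     [seq (a + j%:R) / q%:R | j <- iota 0 q])
    [seq j%:R / (p + q)%:R | j <- iota 1 (p + q).-1]
    z.

End Hypergeometric.

(* A subset of P^{k-1} is represented by the set of the homogeneous coordinate
   vectors (nonzero rows) of its points. *)
Section Projective.
Variables (R : realType) (k : nat).
Local Notation C := (cplx R).
Implicit Types (x y c : 'rV[C]_k) (S X : set 'rV[C]_k).

Definition form_eval d (P : mpoly.dhomog k C d) x : C :=
  mpoly.meval (x 0) (mpoly.mpoly_of_dhomog P).

(* Zariski closure *)
Definition proj_closure S : set 'rV[C]_k :=
  [set x | x != 0 /\
     forall d (P : mpoly.dhomog k C d),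
       (forall y, S y -> form_eval P y = 0) -> form_eval P x = 0].

(* Representatives num/den of the elements of the function field of X; for X
   irreducible, f and g represent the same element when
   num f * den g - num g * den f vanishes on X. *)
Record ratfun X := RatFun {
  rf_degree : nat;
  rf_num : mpoly.dhomog k C rf_degree;
  rf_den : mpoly.dhomog k C rf_degree;
  rf_den_neq0 : exists2 x, X x & form_eval rf_den x != 0
}.

(* f \o s and f are the same element of the function field, for all s in G. *)
Definition invariant X (G : {set {perm 'I_k}}) (f : ratfun X) : Prop :=
  forall s, s \in G -> forall x, X x ->
    form_eval (rf_num f) (col_perm s x) * form_eval (rf_den f) x =
    form_eval (rf_num f) x * form_eval (rf_den f) (col_perm s x).

(* In the next three definitions, cov x z means that the covering of P^1 maps
   the point x to z; it has to give a finite value z at all but finitely many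
   points of X.  The base point is a point of P^1, given by the filter of its
   (punctured or full) neighbourhoods. *)
Definition lies_over X (cov : 'rV[C]_k -> C -> Prop) (base : set_system C) c :
    Prop :=
  X c /\ forall U, base U ->
    \forall x \near c, forall z, X x -> cov x z -> U z.

(* On an irreducible curve the denominator of f has only finitely many zeros,
   so f is compared with F at all but finitely many points near c. *)
Definition agrees_near X (cov : 'rV[C]_k -> C -> Prop) (F : C -> C)
    (f : ratfun X) c : Prop :=
  \forall x \near c, forall z, X x -> cov x z ->
    form_eval (rf_den f) x != 0 ->
    form_eval (rf_num f) x / form_eval (rf_den f) x = F z.

(* F is uniformized by X / G, whose function field is that of the G-invariant
   functions on X and whose points are the G-orbits of points of X.  As f and
   cov are G-invariant, agreement near c is agreement near the orbit of c. *)
Definition uniformized_by_quotient X (G : {set {perm 'I_k}})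
    (cov : 'rV[C]_k -> C -> Prop) (base : set_system C) (F : C -> C) : Prop :=
  exists (f : ratfun X) c,
    [/\ invariant G f, lies_over X cov base c & agrees_near cov F f c].

End Projective.

Section Schwarz.
Variables (R : realType) (p q : nat).
Local Notation C := (cplx R).
Local Notation n := (p + q)%N.

Definition trinomial (g b : C) : {poly C} := 'X^n - g *: 'X^p - b%:P.

Definition zeta_factor : C :=
  (-1) ^+ q * (n%:R ^+ n / (p%:R ^+ p * q%:R ^+ q)).

(* The entries of x are k of the n roots, with multiplicity. *)
Definition roots_of_trinomial k (g b : C) (x : 'rV[C]_k) : Prop :=
  exists (r : 'I_n -> C) (j : 'I_k -> 'I_n),
    [/\ trinomial g b = \prod_i ('X - (r i)%:P),
        injective j & forall i, x 0 i = r (j i)].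

Definition schwarz_locus k : set 'rV[C]_k :=
  [set x | x != 0 /\
     exists g b : C, (g != 0 \/ b != 0) /\ roots_of_trinomial g b x].

Definition schwarz_curve k : set 'rV[C]_k := proj_closure (@schwarz_locus k).

Definition schwarz_zeta k (x : 'rV[C]_k) (z : C) : Prop :=
  exists g b : C, [/\ g != 0, roots_of_trinomial g b x &
                      z = zeta_factor * (b ^+ q / g ^+ n)].

(* P^1_s, with s = x_0 / x_1 *)
Definition line_s : set 'rV[C]_2 := [set x | x != 0].

Definition line_zeta (x : 'rV[C]_2) (z : C) : Prop :=
  exists s : C, [/\ x 0 1 != 0, s = x 0 0 / x 0 1, s != 1 &
                    z = zeta_factor * (s ^+ q / (1 - s) ^+ n)].

(* F is uniformized by the quotient of the k-th curve by the symmetric group,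
   for 1 <= k <= n; for k = 1 the symmetric group is trivial. *)
Definition uniformized_by_symm (k : nat) (base : set_system C) (F : C -> C) :
    Prop :=
  if k == 1%N
  then uniformized_by_quotient line_s [set 1%g] line_zeta base F
  else uniformized_by_quotient (@schwarz_curve k) [set: {perm 'I_k}]
         (@schwarz_zeta k) base F.

End Schwarz.

(* Neighbourhoods of the point at infinity of P^1. *)
Definition nbhs_infty (R : realType) : set_system (cplx R) :=
  [set U | exists2 M : cplx R, 0 < M & forall z : cplx R, M < `|z| -> U z].

(* Main.v *)
(* With n = p + q and g = 1, the root y near 1 of y^n = y^p + t satisfies
   y^q = B, where B = 1 + t B^r and r = -p/q.  By the Rothe-Hagen (Gould)
   convolution, the series B^s = sum_k A_k(s) t^k, with
   A_k(s) = s (s+rk-1) ... (s+rk-k+1) / k!, multiply like powers; together with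
   uniqueness of the root near 1 this gives y^(qs) = sum_k A_k(s) t^k for
   integral s.  The q large roots of x^n - g x^p - b correspond to the arguments
   t o^i with o a primitive q-th root of unity, so summing over them keeps only
   the terms with q | k, and by Gauss's multiplication formula A_{qm}(-a) is the
   m-th coefficient of F^{(q;0)}(a; -).  Hence
   F^{(q;0)}(a; zeta) = q^-1 g^a sum_i x_i^(-qa), a symmetric function on the
   curve, since g = (x_0^n - x_1^n) / (x_0^p - x_1^p).  For a < 0, where the
   function is defined as a limit, one uses that the bounds on A_k(s) are locally
   uniform in s.  As for F^{(n;0)}(a; 1/zeta), its series terminates when a is an
   integer, so it is a polynomial in 1/zeta, which is itself an element of the
   function field. *)

Require Import Defs.
From HB Require Import structures.
From mathcomp Require Import all_boot all_order all_algebra.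
From mathcomp Require Import fingroup perm cyclic separable cyclotomic.
From mathcomp Require Import complex.
From mathcomp Require mpoly.
From mathcomp Require Import all_classical all_reals all_analysis.
From mathcomp Require Import ring lra zify.
Set Implicit Arguments.
Unset Strict Implicit.
Unset Printing Implicit Defensive.
Import Order.TTheory GRing.Theory Num.Theory.
Import numFieldNormedType.Exports.
Local Open Scope classical_set_scope.
Local Open Scope ring_scope.

(** * Coefficients of the powers of B = 1 + t B^r *)

Section Gould.
Variable (F : numFieldType).
Implicit Types (r s t : F).

(* The coefficient of t^k in B^s, where B = 1 + t B^r. *)
Definition gould r s (k : nat) : F :=
  if k is k'.+1 then s * (\prod_(j < k') (s + r * k%:R - j.+1%:R)) / (k`!)%:R
  else 1.

(** For fixed [r] and [k] the coefficient is a polynomial in [s]. This gives continuity in [s] and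
    lets identities be checked at natural numbers only. *)
Definition gould_poly r (k : nat) : {poly F} :=
  if k is k'.+1
  then (k`!)%:R^-1 *: ('X * \prod_(j < k') ('X + (r * k%:R - j.+1%:R)%:P))
  else 1.

Lemma horner_gould_poly r s k : (gould_poly r k).[s] = gould r s k.
Proof.
case: k => [|k]; first by rewrite hornerC.
rewrite /= hornerZ hornerM hornerX horner_prod mulrC; congr (_ * _ * _).
by apply: eq_bigr => j _; rewrite hornerD hornerX hornerC addrA.
Qed.

Lemma gould_at0 r k : gould r 0 k = (k == 0%N)%:R.
Proof. by case: k => //= k; rewrite !mul0r. Qed.

(** Coefficient of t^(k+1) in B^(s+1) - B^s = B^s (B - 1) = t B^(s+r). *)
Lemma gouldS r s k : gould r (s + 1) k.+1 - gould r s k.+1 = gould r (s + r) k.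
Proof.
case: k => [|k] /=; first by rewrite !big_ord0 (_ : 1`! = 1%N) // !divr1 !mulr1; ring.
rewrite big_ord_recl [in X in _ - X]big_ord_recr /=.
have -> : \prod_(i < k) (s + 1 + r * k.+2%:R - (bump 0 i).+1%:R) =
          \prod_(i < k) (s + r * k.+2%:R - i.+1%:R).
  by apply: eq_bigr => j _; rewrite /bump leq0n add1n -[j.+2]addn1 natrD; ring.
have -> : \prod_(j < k) (s + r + r * k.+1%:R - j.+1%:R) =
          \prod_(i < k) (s + r * k.+2%:R - i.+1%:R).
  by apply: eq_bigr => j _; rewrite -[k.+2]addn1 natrD; ring.
set P := \prod_(i < k) _.
rewrite -mulrBl [k.+2`!]factS natrM invfM [LHS]mulrA; congr (_ * _).
apply: (mulIf (x := k.+2%:R)); first by rewrite pnatr_eq0.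
by rewrite divfK ?pnatr_eq0 // -[k.+2]addn1 natrD; ring.
Qed.

Lemma poly_eq_nat (P Q : {poly F}) :
  (forall m : nat, P.[m%:R] = Q.[m%:R]) -> P = Q.
Proof.
move=> eqPQ; apply/eqP; rewrite -subr_eq0; apply/eqP.
apply: (@roots_geq_poly_eq0 _ _ [seq m%:R | m <- iota 0 (size (P - Q))]).
- apply/allP => _ /mapP[m _ ->].
  by rewrite rootE hornerD hornerN eqPQ subrr.
- by rewrite map_inj_uniq ?iota_uniq // => i j /eqP; rewrite eqr_nat => /eqP.
- by rewrite size_map size_iota.
Qed.

(* Both sides are polynomials in s that agree at 0 and, by induction on k,
   have the same first difference. *)
Lemma gould_convolution r s t k :
  \sum_(i < k.+1) gould r s i * gould r t (k - i) = gould r (s + t) k.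
Proof.
elim: k s t => [|k IHk] s t; first by rewrite big_ord1 /= mulr1.
pose P := \sum_(i < k.+2) gould r t (k.+1 - i) *: gould_poly r i.
pose Q := gould_poly r k.+1 \Po ('X + t%:P).
have PE x : P.[x] = \sum_(i < k.+2) gould r x i * gould r t (k.+1 - i).
  rewrite horner_sum; apply: eq_bigr => i _.
  by rewrite hornerZ horner_gould_poly mulrC.
have QE x : Q.[x] = gould r (x + t) k.+1.
  by rewrite horner_comp hornerD hornerX hornerC horner_gould_poly.
rewrite -PE -QE; congr (_.[s]); apply: poly_eq_nat; elim=> [|m IHm].
  rewrite PE QE add0r big_ord_recl big1 ?addr0 ?subn0 ?mul1r //= => i _.
  by rewrite !mul0r.
have dP : P.[m%:R + 1] - P.[m%:R] = gould r (m%:R + r + t) k.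
  rewrite !PE -sumrB big_ord_recl subrr add0r -IHk; apply: eq_bigr => i _.
  by rewrite -mulrBl gouldS.
have dQ : Q.[m%:R + 1] - Q.[m%:R] = gould r (m%:R + r + t) k.
  by rewrite !QE [_ + 1 + t]addrAC gouldS addrAC.
by rewrite -addn1 natrD -[LHS](subrK P.[m%:R]) dP IHm -dQ subrK.
Qed.

Lemma gould1 r k : gould r 1 k.+1 = gould r r k.
Proof. by have := gouldS r 0 k; rewrite !add0r gould_at0 subr0. Qed.

(** With N = S + (p+1)k, the factors are bounded one by one by those of the falling factorial of N,
    taken in reverse order. Hence |A_k(s)| <= 'C(N, k) <= 2^N, uniformly for |s| <= S. *)
Lemma norm_gould_le (p S : nat) r s k : `|r| <= p%:R -> `|s| <= S%:R ->
  `|gould r s k| <= 2 ^+ S * (2 ^+ p.+1) ^+ k.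
Proof.
move=> r_le s_le.
have -> : 2 ^+ S * (2 ^+ p.+1) ^+ k = (2 ^ (S + p.+1 * k))%:R :> F.
  by rewrite natrX exprD exprM.
apply: (@le_trans _ _ 'C(S + p.+1 * k, k)%:R); last first.
  rewrite ler_nat; set N := (S + _)%N; have [kN|Nk] := leqP k N; last first.
    by rewrite bin_small.
  rewrite -[X in (_ <= X ^ _)%N]/(1 + 1)%N expnDn (bigD1 (inord k)) //=.
  by rewrite inordK ?ltnS // !exp1n !muln1 leq_addr.
case: k => [|k]; first by rewrite /= bin0 normr1.
rewrite -(@ler_pM2r _ (k.+1`!)%:R) ?ltr0n ?fact_gt0 // -natrM bin_ffact.
rewrite /= !normrM normfV normr_nat divfK ?pnatr_eq0 -?lt0n ?fact_gt0 //.
rewrite ffact_prod natr_prod big_ord_recr /= mulrC.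
apply: ler_pM; rewrite ?normr_ge0 //; last first.
  apply: (le_trans s_le); rewrite ler_nat; lia.
rewrite [leRHS](reindex_inj rev_ord_inj) normr_prod /=.
apply: ler_prod => j _; rewrite normr_ge0 /=.
rewrite -addrA; apply: (le_trans (ler_normD _ _)).
apply: (@le_trans _ _ (S%:R + (p%:R * k.+1%:R + j.+1%:R))).
  apply: lerD => //; apply: (le_trans (ler_normB _ _)); rewrite normr_nat.
  by rewrite lerD2r normrM normr_nat ler_wpM2r // ler0n.
rewrite -natrM -!natrD ler_nat.
have : (j < k)%N by []. lia.
Qed.

End Gould.

(** * Complex series dominated by geometric series *)

Section ComplexSeries.
Variable R : realType.
Local Notation C := (cplx R).

Lemma real_complex_continuous : continuous (fun x : R => x%:C%C : C).
Proof.
move=> x; apply/cvgrPdist_lt => e e_gt0.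
have [e' e'E] : exists e' : R, e = e'%:C%C by apply/complex_realP; exact: gtr0_real.
have e'_gt0 : 0 < e' by rewrite e'E ltcR in e_gt0.
near=> y.
rewrite e'E -(rmorphB (real_complex R)) normc_def /= expr0n addr0 sqrtr_sqr ltcR.
by near: y; apply: cvgr_dist_lt.
Unshelve. all: by end_near. Qed.

Lemma cvg_complex (u : nat -> C) (a b : R) :
  @complex.Re R \o u @ \oo --> a -> @complex.Im R \o u @ \oo --> b ->
  u @ \oo --> (a%:C%C + 'i%C * b%:C%C : C).
Proof.
move=> ua ub.
rewrite (_ : u = fun n => (complex.Re (u n))%:C%C + 'i%C * (complex.Im (u n))%:C%C); last first.
  by apply/funext => n; rewrite -complexE.
apply: cvgD.
  exact: (cvg_comp _ _ ua (real_complex_continuous (x := a))).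
apply: cvgM; first exact: cvg_cst.
exact: (cvg_comp _ _ ub (real_complex_continuous (x := b))).
Qed.

Lemma lim_norm_le (u : nat -> C) (l z e : C) N : u @ \oo --> l ->
  (forall n, (N <= n)%N -> `|u n - z| <= e) -> `|l - z| <= e.
Proof.
move=> ul ue; rewrite real_leNgt ?ger0_real //; last first.
  exact: le_trans (normr_ge0 _) (ue _ (leqnn N)).
apply/negP => lt_e.
have d_gt0 : 0 < `|l - z| - e by rewrite subr_gt0.
move/cvgrPdist_lt: ul => /(_ _ d_gt0)[M _ HM].
have := ltr_leD (HM (maxn M N) (leq_maxl _ _)) (ue _ (leq_maxr M N)).
rewrite subrK => /(le_lt_trans (ler_normD _ _)).
by rewrite addrA subrK ltxx.
Qed.

Lemma cvg_geometric0 (c : nat) (M : C) : (1 < c)%N ->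
  M * c%:R ^- k @[k --> \oo] --> (0 : C).
Proof.
move=> c_gt1; rewrite -[0 in X in _ --> X](mulr0 M).
apply: cvgM; first exact: cvg_cst.
have -> : (fun k => c%:R ^- k : C) = fun k => ((c%:R^-1 : R) ^+ k)%:C%C.
  apply/funext => k.
  by rewrite rmorphXn fmorphV rmorph_nat exprVn.
have := @cvg_geometric R 1 (c%:R^-1).
rewrite normfV normr_nat invf_lt1 ?ltr0n ?ltr1n; last by apply: leq_trans c_gt1.
move=> /(_ c_gt1); rewrite (_ : geometric _ _ = fun k => c%:R^-1 ^+ k).
  by move=> cv; exact: (cvg_comp _ _ cv (real_complex_continuous (x := 0))).
by apply/funext => k; rewrite /geometric /= mul1r.
Qed.

(** The explicit constant [M] is what later makes tail estimates uniform in a parameter. *)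
Definition geometric_bound (M : C) (c : nat) (u : nat -> C) :=
  forall k, `|u k| <= M * c%:R ^- k.

Lemma geometric_bound_ge0 M c u : geometric_bound M c u -> 0 <= M.
Proof.
by move=> /(_ 0%N); rewrite expr0 invr1 mulr1; apply: le_trans; exact: normr_ge0.
Qed.

Lemma geometric_bound_sum M c u N N' : (1 < c)%N -> geometric_bound M c u ->
  (N <= N')%N -> `|series u N' - series u N| <= 2 * M * c%:R ^- N.
Proof.
move=> c_gt1 uM NN'.
have M_ge0 : 0 <= M by exact: geometric_bound_ge0 uM.
have c_gt0 : 0 < c%:R :> C by rewrite ltr0n; apply: leq_trans c_gt1.
(* The term subtracted on the right makes the bound provable by induction on N' - N. One step
   amounts to 2/c <= 1, which is where c > 1 enters. *)
suff : `|series u N' - series u N| <= 2 * M * c%:R ^- N - 2 * M * c%:R ^- N'.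
  move=> H; apply: le_trans H _; rewrite gerBl.
  by rewrite !mulr_ge0 // invr_ge0 exprn_ge0 // ltW.
rewrite -(subnKC NN'); elim: (N' - N)%N => [|d IHd].
  by rewrite addn0 !subrr normr0.
rewrite addnS seriesSr addrAC.
apply: (le_trans (ler_normD _ _)).
have := lerD IHd (uM (N + d)%N) => /le_trans; apply.
rewrite -addrA lerD2l exprS invfM -subr_ge0.
set y := c%:R ^- _.
rewrite (_ : _ - _ = M * y * (1 - 2 * c%:R^-1)); last by rewrite /y; ring.
rewrite !mulr_ge0 //; first by rewrite invr_ge0 exprn_ge0 // ltW.
by rewrite subr_ge0 ler_pdivrMr // mul1r ler_nat.
Qed.

(** The real and imaginary parts are each dominated by a convergent real geometric series. *)
Lemma geometric_bound_cvg M c u : (1 < c)%N -> geometric_bound M c u ->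
  cvgn (series u).
Proof.
move=> c_gt1 uM.
have M_ge0 : 0 <= M by exact: geometric_bound_ge0 uM.
have [M' M'E] : exists M' : R, M = M'%:C%C by apply/complex_realP; exact: ger0_real.
have part (f : C -> R) : (forall z : C, `|f z|%:C%C <= `|z|) ->
    {morph f : x y / x + y} -> f 0 = 0 ->
    cvgn (f \o series u).
  move=> fle fD f0.
  have -> : f \o series u = series (f \o u).
    apply/funext => n /=; rewrite /series /=.
    by apply: (big_morph f fD f0).
  apply: normed_cvg.
  apply: (@series_le_cvg R _ (geometric M' (c%:R^-1))) => [k|k|k|].
  - exact: normr_ge0.
  - rewrite /geometric /= mulr_ge0 ?exprn_ge0 ?invr_ge0 ?ler0n //.
    by rewrite -lecR -M'E.
  - rewrite -lecR; apply: le_trans (fle _) _; apply: le_trans (uM k) _.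
    by rewrite /geometric /= M'E rmorphM rmorphXn fmorphV rmorph_nat exprVn.
  - apply: is_cvg_geometric_series.
    rewrite normfV normr_nat invf_lt1 ?ltr0n ?ltr1n //.
    by apply: leq_trans c_gt1.
have cRe := part (@complex.Re R).
have cIm := part (@complex.Im R).
have {}cRe : cvgn (@complex.Re R \o series u).
  apply: cRe => [z| |] //; last by move=> [? ?] [? ?].
  exact: normc_ge_Re.
have {}cIm : cvgn (@complex.Im R \o series u).
  apply: cIm => [z| |] //; last by move=> [? ?] [? ?].
  by have := normc_ge_Re (z * 'i%C); rewrite ReiNIm normrN normrM
    [X in _ * X]normc_def /= expr0n add0r expr1n sqrtr1 mulr1.
exact: (cvgP _ (cvg_complex cRe cIm)).
Qed.

Lemma geometric_bound_lim M c u N : (1 < c)%N -> geometric_bound M c u ->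
  `|limn (series u) - series u N| <= 2 * M * c%:R ^- N.
Proof.
move=> c_gt1 uM; apply: (lim_norm_le (N := N) (geometric_bound_cvg c_gt1 uM)).
by move=> n Nn; exact: geometric_bound_sum.
Qed.

Lemma series_convolution (a b : nat -> C) N :
  \sum_(k < N) \sum_(i < k.+1) a i * b (k - i)%N =
  \sum_(i < N) a i * series b (N - i)%N.
Proof.
elim: N => [|N IHN]; first by rewrite !big_ord0.
rewrite !big_ord_recr /= IHN subSnn subnn addrA -big_split /=.
congr (_ + _); last by rewrite /series /= big_nat1.
apply: eq_bigr => i _.
by rewrite subSn ?(ltnW (ltn_ord i)) // seriesSr mulrDr.
Qed.

(** Cauchy product. The N-th partial sum differs from (series a N) B by N terms a_i (tail of b after
    N - i), each at most 2 M^2 4^-N; since N <= 2^N, their sum is at most 2 M^2 2^-N. *)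
Lemma cvg_convolution M (a b : nat -> C) :
  geometric_bound M 4 a -> geometric_bound M 4 b ->
  (fun N => \sum_(k < N) \sum_(i < k.+1) a i * b (k - i)%N) @ \oo -->
  limn (series a) * limn (series b).
Proof.
move=> aM bM; set A := limn (series a); set B := limn (series b).
have cvA : series a @ \oo --> A by exact: geometric_bound_cvg aM.
pose err N := \sum_(i < N) a i * (B - series b (N - i)%N).
have errE N : \sum_(k < N) \sum_(i < k.+1) a i * b (k - i)%N = series a N * B - err N.
  rewrite series_convolution /series /= big_mkord mulr_suml -sumrB.
  by apply: eq_bigr => i _; rewrite -mulrBr opprB addrC subrK.
rewrite (_ : (fun N => _) = fun N => series a N * B - err N); last first.
  by apply/funext => N; exact: errE.
rewrite -[X in _ --> X]subr0; apply: cvgB.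
  exact: (cvgM cvA (cvg_cst B)).
have M_ge0 : 0 <= M by exact: geometric_bound_ge0 aM.
have err_le N : `|err N| <= 2 * M ^+ 2 * 2%:R ^- N.
  apply: le_trans (ler_norm_sum _ _ _) _.
  apply: (@le_trans _ _ (\sum_(i < N) 2 * M ^+ 2 * 4%:R ^- N)).
    apply: ler_sum => i _; rewrite normrM.
    have := ler_pM (normr_ge0 _) (normr_ge0 _) (aM i)
      (geometric_bound_lim (N - i) (isT : 1 < 4)%N bM).
    move=> /le_trans; apply; rewrite -[in leRHS](subnKC (ltnW (ltn_ord i))).
    by rewrite exprD invfM le_eqVlt; apply/orP; left; apply/eqP; ring.
  rewrite sumr_const card_ord -mulrnAr ler_wpM2l ?mulr_ge0 ?exprn_ge0 //.
  rewrite (_ : 4%:R = 2%:R * 2%:R :> C); last by rewrite -natrM.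
  rewrite exprMn invfM -mulrnAr ler_piMr ?invr_ge0 ?exprn_ge0 ?ler0n //.
  rewrite -[_ *+ N]mulr_natr mulrC ler_pdivrMr ?exprn_gt0 ?ltr0n // mul1r -natrX ler_nat.
  by apply: ltnW; apply: ltn_expl.
apply/cvgrPdist_lt => e e_gt0.
have /cvgrPdist_lt/(_ _ e_gt0) := @cvg_geometric0 2 (2 * M ^+ 2) isT.
apply: filterS => N; rewrite !sub0r !normrN; apply: le_lt_trans.
by rewrite [leRHS]ger0_norm //; exact: le_trans (normr_ge0 _) (err_le N).
Qed.

End ComplexSeries.

(** * The root near 1 of y^(p+q) = y^p + t *)

Section GouldSeries.
Variable R : realType.
Local Notation C := (cplx R).

Lemma cvgX_complex (T : Type) (F : set_system T) (FF : Filter F) (f : T -> C)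
  (a : C) m : f @ F --> a -> f x ^+ m @[x --> F] --> a ^+ m.
Proof.
move=> fa; elim: m => [|m IHm]; first exact: cvg_cst.
under eq_cvg do rewrite exprS.
by rewrite exprS; exact: (cvgM fa IHm).
Qed.

Lemma cvg_sum_complex (T : Type) (F : set_system T) (FF : Filter F) m
  (f : 'I_m -> T -> C) (a : 'I_m -> C) : (forall i, f i @ F --> a i) ->
  \sum_(i < m) f i x @[x --> F] --> \sum_(i < m) a i.
Proof. by move=> fa; apply: cvg_big => [|i _]; [exact: add_continuous | exact: fa]. Qed.

Implicit Types (r s t : C).

Definition gould_term r s t (k : nat) : C := gould r s k * t ^+ k.

Definition gould_series r s t : C := limn (series (gould_term r s t)).

Lemma norm_le_nat (z : C) : exists S : nat, `|z| <= S%:R.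
Proof.
exists (Num.bound (Num.sqrt (complex.Re z ^+ 2 + complex.Im z ^+ 2))).
rewrite normc_def -(rmorph_nat (real_complex R)) lecR.
exact: ltW (archi_boundP (sqrtr_ge0 _)).
Qed.

(** The radius 2^-(p+3) turns the growth rate 2^(p+1) of the coefficients into the ratio 1/4. The
    shifted index serves to extract a factor t from B^s - 1. *)
Lemma gould_term_boundS (p S : nat) r s t : `|r| <= p%:R -> `|s| <= S%:R ->
  `|t| <= 2 ^- p.+3 ->
  geometric_bound (2 ^+ S * 2 ^+ p.+1) 4 (fun k => gould r s k.+1 * t ^+ k).
Proof.
move=> r_le s_le t_le k; rewrite normrM normrX.
have t_leX : `|t| ^+ k <= (2 ^- p.+3) ^+ k.
  by apply: lerXn2r => //; rewrite nnegrE ?invr_ge0 ?exprn_ge0.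
have := ler_pM (normr_ge0 _) (exprn_ge0 k (normr_ge0 _)) (norm_gould_le k.+1 r_le s_le) t_leX.
move=> /le_trans; apply; rewrite le_eqVlt; apply/orP; left; apply/eqP.
rewrite exprS -!mulrA; congr (_ * (_ * _)).
rewrite -exprMn -[RHS]exprVn; congr (_ ^+ _); rewrite !exprS; field.
by rewrite expf_neq0 ?pnatr_eq0.
Qed.

Lemma gould_term_bound (p S : nat) r s t : `|r| <= p%:R -> `|s| <= S%:R ->
  `|t| <= 2 ^- p.+3 -> geometric_bound (2 ^+ S) 4 (gould_term r s t).
Proof.
move=> r_le s_le t_le k; rewrite normrM normrX.
have t_leX : `|t| ^+ k <= (2 ^- p.+3) ^+ k.
  by apply: lerXn2r => //; rewrite nnegrE ?invr_ge0 ?exprn_ge0.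
have := ler_pM (normr_ge0 _) (exprn_ge0 k (normr_ge0 _)) (norm_gould_le k r_le s_le) t_leX.
move=> /le_trans; apply; rewrite le_eqVlt; apply/orP; left; apply/eqP.
rewrite -!mulrA; congr (_ * _).
rewrite -exprMn -[RHS]exprVn; congr (_ ^+ _); rewrite !exprS; field.
by rewrite expf_neq0 ?pnatr_eq0.
Qed.

(** * Power laws of the series B^s for small t *)

Section SmallArgument.
Variables (p : nat) (r t : C).
Hypotheses (r_le : `|r| <= p%:R) (t_le : `|t| <= 2 ^- p.+3).

Lemma gould_series_cvg s :
  series (gould_term r s t) @ \oo --> gould_series r s t.
Proof.
have [S s_le] := norm_le_nat s.
exact: geometric_bound_cvg (gould_term_bound r_le s_le t_le).
Qed.

(** B^(s+s') = B^s B^s', from the Cauchy product and the convolution identity for the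
    coefficients. *)
Lemma gould_seriesD s s' :
  gould_series r (s + s') t = gould_series r s t * gould_series r s' t.
Proof.
have [S s_le] := norm_le_nat s; have [S' s'_le] := norm_le_nat s'.
have le1 : `|s| <= (S + S')%:R by rewrite (le_trans s_le) // ler_nat leq_addr.
have le2 : `|s'| <= (S + S')%:R by rewrite (le_trans s'_le) // ler_nat leq_addl.
have := cvg_convolution (gould_term_bound r_le le1 t_le) (gould_term_bound r_le le2 t_le).
rewrite (_ : (fun N => _) = series (gould_term r (s + s') t)) => [/cvg_lim|].
  by apply; exact: norm_hausdorff.
apply/funext => N; rewrite /series /= big_mkord; apply: eq_bigr => k _.
rewrite /gould_term -gould_convolution mulr_suml; apply: eq_bigr => i _.
by rewrite mulrACA -exprD subnKC // -ltnS.
Qed.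

Lemma gould_series0 : gould_series r 0 t = 1.
Proof.
apply: cvg_lim; first exact: norm_hausdorff.
rewrite -(cvg_shiftS _ (nbhs (1 : C))).
rewrite (_ : [sequence _]_n = fun=> 1); first exact: cvg_cst.
apply/funext => n; rewrite /series /= big_nat_recl // big1 ?addr0.
  by rewrite /gould_term /= mulr1.
by move=> i _; rewrite /gould_term gould_at0 mul0r.
Qed.

Lemma gould_series1 : gould_series r 1 t = 1 + t * gould_series r r t.
Proof.
apply: cvg_lim; first exact: norm_hausdorff.
rewrite -(cvg_shiftS _ (nbhs (1 + t * gould_series r r t))).
rewrite (_ : [sequence _]_n = fun n => 1 + t * series (gould_term r r t) n).
  apply: cvgD; first exact: cvg_cst.
  by apply: cvgM; [exact: cvg_cst | exact: gould_series_cvg].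
apply/funext => n; rewrite /series /= big_nat_recl //; congr (_ + _).
  by rewrite /gould_term /= mulr1.
rewrite mulr_sumr; apply: eq_bigr => i _.
by rewrite /gould_term gould1 exprS mulrCA.
Qed.

Lemma gould_series_neq0 s : gould_series r s t != 0.
Proof.
apply/eqP => B0; have := gould_seriesD s (- s).
by rewrite subrr gould_series0 B0 mul0r => /eqP; rewrite oner_eq0.
Qed.

Lemma gould_seriesX s m :
  gould_series r (m%:R * s) t = gould_series r s t ^+ m.
Proof.
elim: m => [|m IHm]; first by rewrite mul0r gould_series0.
by rewrite exprS -IHm -gould_seriesD -natr1 mulrDl mul1r addrC.
Qed.

Lemma gould_series_int (a : int) :
  gould_series r a%:~R t = gould_series r 1 t ^ a.
Proof.
case: a => m; first by rewrite -exprnP -gould_seriesX mulr1.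
rewrite NegzE -exprz_inv -exprnP exprVn -gould_seriesX mulr1.
apply: (mulIf (gould_series_neq0 (m.+1)%:R)).
rewrite -gould_seriesD mulVf ?gould_series_neq0 //.
by rewrite rmorphN /= addNr gould_series0.
Qed.

(** The constant term is 1 and the remaining terms share a factor t. This keeps the root given by
    the series close to 1. *)
Lemma gould_series_sub1 S s : `|s| <= S%:R ->
  `|gould_series r s t - 1| <= 2 ^+ (S + p).+2 * `|t|.
Proof.
move=> s_le; apply: (lim_norm_le (N := 1) (gould_series_cvg (s := s))) => -[//|n] _.
rewrite /series /= big_nat_recl // {1}/gould_term /= mulr1 addrAC subrr add0r.
have := geometric_bound_sum (isT : (1 < 4)%N) (gould_term_boundS r_le s_le t_le) (leq0n n).
rewrite {2}/series /= big_geq // subr0 expr0 invr1 mulr1 => le_n.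
rewrite (_ : \sum_(0 <= i < n) _ = t * series (fun k => gould r s k.+1 * t ^+ k) n).
  rewrite normrM mulrC ler_wpM2r ?normr_ge0 //; apply: le_trans le_n _.
  by rewrite -exprD -exprS; rewrite addnS.
rewrite /series /= mulr_sumr; apply: eq_bigr => i _.
by rewrite /gould_term exprS mulrCA.
Qed.

End SmallArgument.

(** * Identification of the series with the root near 1 *)

Section Branch.
Variables p q : nat.
Hypotheses (q_gt0 : (0 < q)%N).
Let r : C := - (p%:R / q%:R).

Lemma norm_slope_le : `|r| <= p%:R.
Proof.
rewrite normrN normrM normfV !normr_nat ler_pdivrMr ?ltr0n //.
by rewrite -natrM ler_nat leq_pmulr.
Qed.

(** For v = B^(1/q): v^(p+q) = v^p B = v^p (1 + t B^r), and v^p B^r = B^(p/q) B^(-p/q) = 1. *)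
Lemma gould_series_root t : `|t| <= 2 ^- p.+3 ->
  let v := gould_series r q%:R^-1 t in
  gould_series r 1 t = v ^+ q /\ v ^+ (p + q) = v ^+ p + t.
Proof.
move=> t_le v; have q_neq0 : q%:R != 0 :> C by rewrite pnatr_eq0 -lt0n.
have vq : gould_series r 1 t = v ^+ q.
  by rewrite -(gould_seriesX norm_slope_le t_le) divff.
split => //; rewrite exprD -vq (gould_series1 norm_slope_le t_le) mulrDr mulr1.
congr (_ + _); rewrite mulrCA -(gould_seriesX norm_slope_le t_le).
by rewrite -(gould_seriesD norm_slope_le t_le) addrN gould_series0 // mulr1.
Qed.

(** For two roots y, v with the same t, (y - v) E(y, v) = 0, where E is the divided difference of
    y^(p+q) - y^p. As E(1, 1) = (p + q) - p = q is nonzero, E does not vanish near (1, 1). *)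
Lemma trinomial_root_unique :
  exists2 e : C, 0 < e & forall y v t : C, `|1 - y| < e -> `|1 - v| < e ->
    y ^+ (p + q) = y ^+ p + t -> v ^+ (p + q) = v ^+ p + t -> y = v.
Proof.
pose E (z : C * C) := \sum_(i < p + q) z.1 ^+ ((p + q).-1 - i) * z.2 ^+ i -
                \sum_(i < p) z.1 ^+ (p.-1 - i) * z.2 ^+ i.
have EE y v t : y ^+ (p + q) = y ^+ p + t -> v ^+ (p + q) = v ^+ p + t ->
    (y - v) * E (y, v) = 0.
  by move=> yt vt; rewrite mulrBr -!subrXX yt vt; ring.
have cvgS m : \sum_(i < m) z.1 ^+ (m.-1 - i) * z.2 ^+ i @[z --> (1 : C, 1 : C)] -->
    \sum_(i < m) (1 : C) ^+ (m.-1 - i) * 1 ^+ i.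
  apply: cvg_sum_complex => i.
  by apply: cvgM; apply: cvgX_complex; [exact: cvg_fst | exact: cvg_snd].
have cvgE : E z @[z --> (1 : C, 1 : C)] --> (q%:R : C).
  rewrite (_ : q%:R = \sum_(i < p + q) 1 ^+ ((p + q).-1 - i) * 1 ^+ i -
                     \sum_(i < p) 1 ^+ (p.-1 - i) * 1 ^+ i :> C).
    exact: cvgB (cvgS (p + q)%N) (cvgS p).
  have sum1 m : \sum_(i < m) (1 : C) ^+ (m.-1 - i) * 1 ^+ i = m%:R.
    under eq_bigr do rewrite !expr1n mulr1.
    by rewrite sumr_const card_ord.
  by rewrite !sum1 natrD addrAC subrr add0r.
have q_neq0 : q%:R != 0 :> C by rewrite pnatr_eq0 -lt0n.
have [e /= e_gt0 He] : nbhs_ball (1 : C, 1 : C) (fun z => E z != 0).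
  by apply/nbhs_ballP; exact: cvgr_neq0 cvgE q_neq0.
exists e => // y v t ye ve yt vt; apply/eqP; rewrite -subr_eq0.
have := EE _ _ _ yt vt => /eqP; rewrite mulf_eq0 => /orP[] // /eqP E0.
by have := He (y, v) (conj ye ve); rewrite /= E0 eqxx.
Qed.

(** The neighbourhood is one of y, with t = y^(p+q) - y^p determined by y. For y near 1 this t is
    small, so the series root v is near 1 as well and uniqueness gives y = v. *)
Lemma gould_series_branch :
  \forall y \near (1 : C), forall t, y ^+ (p + q) = y ^+ p + t ->
    forall a : int, series (gould_term r a%:~R t) @ \oo --> (y ^+ q) ^ a.
Proof.
have [e e_gt0 He] := trinomial_root_unique.
have q1_le : `|q%:R^-1 : C| <= 1%:R.
  by rewrite normfV normr_nat invf_le1 ?ltr0n // ler1n.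
have cvg1 : (fun y : C => y) @ (1 : C) --> (1 : C) by exact: cvg_id.
have cvgt : (y ^+ (p + q) - y ^+ p) @[y --> (1 : C)] --> (0 : C).
  rewrite (_ : 0 = 1 ^+ (p + q) - 1 ^+ p); last by rewrite !expr1n subrr.
  exact: cvgB (@cvgX_complex _ _ _ _ _ (p + q) cvg1) (@cvgX_complex _ _ _ _ _ p cvg1).
have d_gt0 : (0 : C) < 2 ^- p.+3 by rewrite invr_gt0 exprn_gt0.
have c_gt0 : (0 : C) < 2 ^+ (1 + p).+2 by rewrite exprn_gt0.
near=> y => t yt a.
have tE : `|t| = `|0 - (y ^+ (p + q) - y ^+ p)|.
  by rewrite sub0r normrN yt addrAC subrr add0r.
have t_le : `|t| <= 2 ^- p.+3.
  by rewrite tE ltW //; near: y; exact: cvgr_dist_lt cvgt _ d_gt0.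
have [B1 vE] := gould_series_root t_le; set v := gould_series r q%:R^-1 t in B1 vE.
have -> : y = v.
  apply: (He _ _ t _ _ yt vE); first by near: y; apply: cvgr_dist_lt cvg1 _ _.
  rewrite distrC; apply: le_lt_trans (gould_series_sub1 norm_slope_le t_le q1_le) _.
  rewrite mulrC -ltr_pdivlMr // tE; near: y.
  by apply: cvgr_dist_lt cvgt _ _; exact: divr_gt0.
rewrite -B1 -(gould_series_int norm_slope_le t_le).
exact: gould_series_cvg norm_slope_le t_le _.
Unshelve. all: by end_near. Qed.

End Branch.
End GouldSeries.

(** * The hypergeometric function of part (i) *)

Section Pochhammer.
Variable R : realType.
Local Notation C := (cplx R).
Implicit Types (u a : C).

Lemma pochhammerD u k l :
  pochhammer u (k + l) = pochhammer u k * \prod_(j < l) (u + (k + j)%:R).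
Proof. by rewrite /pochhammer big_split_ord. Qed.

Lemma pochhammer1 k : pochhammer (1 : C) k = (k`!)%:R.
Proof.
elim: k => [|k IHk]; first by rewrite /pochhammer big_ord0.
rewrite /pochhammer big_ord_recr /= -/(pochhammer _ _) IHk factS natrM mulrC.
by rewrite -natr1 addrC.
Qed.

(** Gauss's multiplication formula: raising m by one appends the n consecutive factors a + nm + j,
    each divided by n. *)
Lemma pochhammer_gauss_mul n a m : (0 < n)%N ->
  \prod_(j < n) pochhammer ((a + j%:R) / n%:R) m =
  pochhammer a (n * m) / n%:R ^+ (n * m).
Proof.
move=> n_gt0; have n_neq0 : n%:R != 0 :> C by rewrite pnatr_eq0 -lt0n.
elim: m => [|m IHm].
  rewrite muln0 {2}/pochhammer big_ord0 invr1 mulr1 big1 // => j _.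
  by rewrite /pochhammer big_ord0.
under eq_bigr do rewrite /pochhammer big_ord_recr /= -/(pochhammer _ _).
rewrite big_split /= IHm mulnS addnC pochhammerD exprD invfM mulrACA; congr (_ * _).
rewrite -[n in X in _ = _ / _ ^+ X](card_ord n) -prodr_const -prodfV -big_split /=.
apply: eq_bigr => j _.
by rewrite natrD natrM; field.
Qed.

Lemma prod_pochhammer_iota0 n a m : (0 < n)%N ->
  \prod_(u <- [seq (a + j%:R) / n%:R | j <- iota 0 n]) pochhammer u m =
  pochhammer a (n * m) / n%:R ^+ (n * m).
Proof.
move=> n_gt0; rewrite big_map -pochhammer_gauss_mul //.
by rewrite -[in iota 0 n](subn0 n) -/(index_iota 0 n) big_mkord.
Qed.

Lemma prod_pochhammer_iota1 n a m : (0 < n)%N ->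
  \prod_(u <- [seq (a + j%:R) / n%:R | j <- iota 1 n]) pochhammer u m =
  pochhammer (a + 1) (n * m) / n%:R ^+ (n * m).
Proof.
move=> n_gt0; rewrite -prod_pochhammer_iota0 // -[1%N]addn0 iotaDl -map_comp.
by rewrite !big_map; apply: eq_bigr => j _; rewrite /= natrD addrA.
Qed.

(** The factor m! of the hypergeometric term supplies the missing parameter q/q = 1, which completes
    the list to which Gauss's formula applies. *)
Lemma prod_pochhammer_frac q m : (0 < q)%N ->
  (\prod_(u <- [seq j%:R / q%:R : C | j <- iota 1 q.-1]) pochhammer u m) * (m`!)%:R =
  ((q * m)`!)%:R / q%:R ^+ (q * m).
Proof.
move=> q_gt0; have q_neq0 : q%:R != 0 :> C by rewrite pnatr_eq0 -lt0n.
have := @prod_pochhammer_iota1 q 0 m q_gt0; rewrite add0r pochhammer1 => <-.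
rewrite -[in iota 1 q](prednK q_gt0) -[q.-1.+1]addn1 iotaD map_cat big_cat /=.
rewrite big_cons big_nil mulr1 add0r add1n prednK // divff // pochhammer1.
by congr (_ * _); rewrite !big_map; apply: eq_bigr => j _; rewrite add0r.
Qed.

(** For k = qm the shift rk is the integer -pm. So the product in A_k(-a) is, up to sign, the last
    qm - 1 factors of [pochhammer a ((p + q) * m)]; before them come the factor a and the pm factors
    of [pochhammer (a + 1) (p * m)], which cancel. *)
Lemma gould_pochhammer (p q m : nat) a : (0 < q)%N ->
  pochhammer (a + 1) (p * m) != 0 ->
  gould (- (p%:R / q%:R)) (- a) (q * m) =
  (-1) ^+ (q * m) * (pochhammer a ((p + q) * m) /
    (pochhammer (a + 1) (p * m) * ((q * m)`!)%:R)).
Proof.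
move=> q_gt0; have q_neq0 : q%:R != 0 :> C by rewrite pnatr_eq0 -lt0n.
case: m => [|m]; first by rewrite !muln0 /pochhammer !big_ord0 /= mulr1 divff // mulr1.
have [k kE] : exists k, (q * m.+1 = k.+1)%N.
  by exists (q * m.+1).-1; rewrite prednK // muln_gt0 q_gt0.
rewrite mulnDl kE; have [P PE] : exists P, P = (p * m.+1)%N by exists (p * m.+1)%N.
rewrite -PE => P_neq0.
rewrite addnS -[(P + k).+1]add1n pochhammerD.
rewrite {1}/pochhammer big_ord1 addr0.
have -> : \prod_(j < P + k) (a + (1 + j)%:R) =
   pochhammer (a + 1) P * \prod_(j < k) (a + 1 + (P + j)%:R).
  by rewrite -pochhammerD; apply: eq_bigr => j _; rewrite natrD addrA.
rewrite [a * _]mulrCA -mulf_div divff // mul1r [RHS]mulrA /=; congr (_ / _).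
rewrite (_ : (-1) ^+ k.+1 * (a * \prod_(j < k) (a + 1 + (P + j)%:R)) =
  - a * ((-1) ^+ k * \prod_(j < k) (a + 1 + (P + j)%:R))); last by rewrite exprS; ring.
congr (_ * _).
rewrite -[in (-1) ^+ k](card_ord k) -prodr_const -big_split /=; apply: eq_bigr => j _.
have -> : - (p%:R / q%:R) * k.+1%:R = - P%:R :> C.
  by rewrite PE -kE !natrM mulNr; congr (- _); field.
by rewrite natrD -[j.+1]addn1 natrD; ring.
Qed.

Definition hypergeometric_term (us ls : seq C) (z : C) (k : nat) : C :=
  (\prod_(u <- us) pochhammer u k)
      / ((\prod_(l <- ls) pochhammer l k) * (k`!)%:R) * z ^+ k.

Variables p q : nat.
Hypotheses (p_gt0 : (0 < p)%N) (q_gt0 : (0 < q)%N).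
Let r : C := - (p%:R / q%:R).
Let K := zeta_factor R p q.

Lemma zeta_factor_neq0 : K != 0.
Proof.
by rewrite /K /zeta_factor !mulf_neq0 ?invr_neq0 ?mulf_neq0 ?expf_neq0 ?oppr_eq0 ?oner_eq0 ?pnatr_eq0
  -?lt0n ?addn_gt0 ?p_gt0.
Qed.

(** The normalization of zeta by [K] absorbs the powers of p+q, p and q left by Gauss's formula,
    together with the sign (-1)^(qm). *)
Lemma hypergeometric_term_gould a w m : pochhammer (a + 1) (p * m) != 0 ->
  hypergeometric_term (upper_q p q a) (lower_q p q a) (K * w) m =
  gould r (- a) (q * m) * w ^+ m.
Proof.
move=> poch_neq0; rewrite /hypergeometric_term /upper_q /lower_q big_cat /=.
rewrite prod_pochhammer_iota0 ?addn_gt0 ?p_gt0 // prod_pochhammer_iota1 //.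
rewrite -[X in _ / X]mulrA prod_pochhammer_frac // gould_pochhammer //.
rewrite exprMn mulrA; congr (_ * _).
rewrite /K /zeta_factor !exprMn exprVn -!exprM !exprMn -!exprM.
set A := pochhammer a _; set B := pochhammer (a + 1) _ in poch_neq0 *.
set F := _`!%:R.
have F_neq0 : F != 0 by rewrite pnatr_eq0 -lt0n fact_gt0.
have [n0 p0 q0] : [/\ (p + q)%:R ^+ ((p + q) * m) != 0 :> C,
    p%:R ^+ (p * m) != 0 :> C & q%:R ^+ (q * m) != 0 :> C].
  by split; rewrite expf_neq0 // pnatr_eq0 -lt0n // addn_gt0 p_gt0.
move: n0 p0 q0.
set N := _ ^+ _; set P := _ ^+ _; set Q := _ ^+ _ => n0 p0 q0.
by field; rewrite n0 p0 q0 F_neq0 poch_neq0.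
Qed.

(** The terms of the series of B^(-a) whose index is divisible by q, with w = t^q. Unlike the
    hypergeometric series it has no parameter-dependent denominators, so it makes sense at the
    degenerate integers too. *)
Definition gould_subseries a w : C :=
  limn (series (fun m => gould r (- a) (q * m) * w ^+ m)).

Lemma hypergeometric_gould a w :
  (forall m, pochhammer (a + 1) (p * m) != 0) ->
  hypergeometric (upper_q p q a) (lower_q p q a) (K * w) = gould_subseries a w.
Proof.
move=> poch_neq0; rewrite /hypergeometric /gould_subseries; congr (limn (series _)).
by apply/funext => m; rewrite -hypergeometric_term_gould.
Qed.

Lemma gould_subseries_bound S a w : `|a| <= S%:R -> `|w| <= (2 ^- p.+3) ^+ q ->
  geometric_bound (2 ^+ S) (4 ^ q) (fun m => gould r (- a) (q * m) * w ^+ m).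
Proof.
move=> a_le w_le m; rewrite normrM normrX.
have w_leX : `|w| ^+ m <= (2 ^- p.+3) ^+ q ^+ m.
  by apply: lerXn2r => //; rewrite nnegrE ?exprn_ge0 ?invr_ge0 ?exprn_ge0.
rewrite -normrN in a_le.
have := ler_pM (normr_ge0 _) (exprn_ge0 m (normr_ge0 _))
  (norm_gould_le (q * m) (norm_slope_le R p q_gt0) a_le) w_leX.
move=> /le_trans; apply; rewrite le_eqVlt; apply/orP; left; apply/eqP.
rewrite -!mulrA; congr (_ * _); rewrite natrX -[in RHS]exprM -[X in _ * X]exprM -exprMn.
rewrite -[RHS]exprVn; congr (_ ^+ _); rewrite !exprS; field.
by rewrite expf_neq0 ?pnatr_eq0.
Qed.

Lemma gould_continuous s k : gould r x k @[x --> nbhs s] --> gould r s k.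
Proof.
have gE x : gould r x k = \sum_(i < size (gould_poly r k)) (gould_poly r k)`_i * x ^+ i.
  by rewrite -horner_gould_poly horner_coef.
under eq_cvg do rewrite gE.
rewrite gE.
apply: cvg_sum_complex => i; apply: cvgM; first exact: cvg_cst.
by apply: cvgX_complex; exact: cvg_id.
Qed.

(** Partial sums are polynomials in a, and the tail bound is locally uniform in a. *)
Lemma gould_subseries_continuous a w : `|w| <= (2 ^- p.+3) ^+ q ->
  gould_subseries x w @[x --> nbhs a] --> gould_subseries a w.
Proof.
move=> w_le; have [S aS] := norm_le_nat a.
have c_gt1 : (1 < 4 ^ q)%N by rewrite -(expn0 4) ltn_exp2l.
apply/cvgrPdist_lt => e e_gt0.
have e2_gt0 : 0 < e / 2 by rewrite divr_gt0.
(* The factor 4 covers two tails of at most 2 M c^-N each. The exponent [S.+1] bounds |x| when x is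
   within distance 1 of a. *)
have [N N_lt] : exists N, 4 * 2 ^+ S.+1 * (4 ^ q)%:R ^- N < e / 2 :> C.
  have /cvgrPdist_lt/(_ _ e2_gt0)[N _ HN] := @cvg_geometric0 R _ (4 * 2 ^+ S.+1) c_gt1.
  exists N; apply: le_lt_trans (HN N (leqnn N)); rewrite /= sub0r normrN.
  by apply: real_ler_norm; rewrite ger0_real // !mulr_ge0 ?invr_ge0 ?exprn_ge0 ?ler0n.
pose P x := series (fun m => gould r (- x) (q * m) * w ^+ m) N.
have cvgP : P x @[x --> nbhs a] --> P a.
  rewrite /P /series /= big_mkord; under eq_cvg do rewrite big_mkord.
  apply: cvg_sum_complex => i; apply: cvgM; last exact: cvg_cst.
  have cvgN : (- x) @[x --> nbhs a] --> - a by apply: cvgN; exact: cvg_id.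
  exact: (cvg_comp _ _ cvgN (@gould_continuous (- a) (q * i))).
have cvga : (fun x : C => x) @ nbhs a --> a by exact: cvg_id.
near=> x.
have xS : `|x| <= S.+1%:R.
  have -> : x = a - (a - x) by ring.
  rewrite -natr1; apply: le_trans (ler_normB _ _) _; apply: lerD aS (ltW _).
  by near: x; apply: cvgr_dist_lt cvga _ _; exact: ltr01.
have aS1 : `|a| <= S.+1%:R by rewrite (le_trans aS) // ler_nat.
have tail y : `|y| <= S.+1%:R -> `|gould_subseries y w - P y| <= 2 * 2 ^+ S.+1 * (4 ^ q)%:R ^- N.
  by move=> yS; exact: geometric_bound_lim c_gt1 (gould_subseries_bound yS w_le).
have Ta := tail _ aS1; have := tail _ xS; rewrite distrC => Tx.
have Px : `|P a - P x| < e / 2 by near: x; exact: cvgr_dist_lt cvgP _ e2_gt0.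
move: (gould_subseries a w) (gould_subseries x w) (P a) (P x) Ta Tx Px => A X Pa X' Ta Tx Px.
have -> : A - X = (A - Pa) + ((Pa - X') + (X' - X)) by ring.
apply: le_lt_trans (ler_normD _ _) _.
apply: le_lt_trans (lerD Ta (ler_normD _ _)) _.
rewrite addrCA [ltRHS]splitr; apply: ltr_leD Px _.
apply: le_trans (lerD (lexx _) Tx) _; apply: le_trans _ (ltW N_lt).
by rewrite le_eqVlt; apply/orP; left; apply/eqP; ring.
Unshelve. all: by end_near. Qed.

Lemma pochhammer_neq0 u k : (forall j, (j < k)%N -> u + j%:R != 0) ->
  pochhammer u k != 0.
Proof. by move=> u_neq0; apply/prodf_neq0 => j _; exact: u_neq0. Qed.

(** Every negative integer falls under the limit clause, so outside that clause a >= 0 and no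
    denominator vanishes. *)
Lemma negative_degenerate (b : nat) : degenerate_q p q (- b.+1%:R : C).
Proof.
have n_gt0 : (0 < p + q)%N by rewrite addn_gt0 p_gt0.
(* Euclidean division of b+1 = -a. The lower offsets run from 1 to p, so the remainder there is that
   of b plus one; the upper offsets run from 0 to p+q-1. *)
exists (b %/ p)%N, (b.+1 %/ (p + q))%N; split.
- rewrite leq_divRL //.
  have := leq_trunc_div b.+1 (p + q); have [->|k_gt0] := posnP (b.+1 %/ (p + q))%N.
    by rewrite mul0n.
  move=> le_b; rewrite -ltnS; apply: leq_trans le_b.
  rewrite mulnDr -addn1 leq_add2l muln_gt0 k_gt0.
  exact: q_gt0.
- rewrite mem_cat; apply/orP; left; apply/mapP; exists (b %% p).+1%N.
    by rewrite mem_iota /= add1n ltnS ltn_mod.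
  have bE : b.+1%:R = (b %/ p)%N%:R * p%:R + (b %% p).+1%:R :> C.
    by rewrite -natrM -natrD addnS -divn_eq.
  have p_neq0 : p%:R != 0 :> C by rewrite pnatr_eq0 -lt0n.
  by rewrite bE; field.
- apply/mapP; exists (b.+1 %% (p + q))%N.
    by rewrite mem_iota /= add0n ltn_mod.
  have n_neq0 : (p + q)%:R != 0 :> C by rewrite pnatr_eq0 -lt0n.
  have bE : b.+1%:R = (b.+1 %/ (p + q))%N%:R * (p + q)%:R + (b.+1 %% (p + q))%:R :> C.
    by rewrite -natrM -natrD -divn_eq.
  by rewrite bE opprD -addrA addNr addr0 mulNr mulfK.
Qed.

(** A zero occurs only at a negative integer x, and the punctured unit disc around a contains no
    integer. *)
Lemma near_int_pochhammer (a : int) :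
  \forall x \near (a%:~R : C)^', forall m, pochhammer (x + 1) m != 0.
Proof.
have cvga : (fun x : C => x) @ (a%:~R : C) --> (a%:~R : C) by exact: cvg_id.
rewrite near_withinE.
near=> x => x_neq m; apply: pochhammer_neq0 => j _.
apply/negP => /eqP xE; case/negP: x_neq; apply/eqP.
have {}xE : x = (- (1 + j)%N%:Z)%:~R.
  move/eqP: xE; rewrite -addrA addr_eq0 => /eqP ->.
  by rewrite mulrNz -pmulrn natrD.
have : `|a%:~R - x| < 1 by near: x; apply: cvgr_dist_lt cvga _ _; exact: ltr01.
rewrite xE -rmorphB /= -intr_norm -[1]/(1%:~R) ltr_int => lt1; congr (_%:~R).
by lia.
Unshelve. all: by end_near. Qed.

(** In the limit clause, the two functions agree on a punctured neighbourhood of a, and continuity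
    of the subseries in a identifies the limit. *)
Lemma hyperF_q_gould (a : int) w : `|w| <= (2 ^- p.+3) ^+ q ->
  hyperF_q p q a%:~R (K * w) = gould_subseries a%:~R w.
Proof.
move=> w_le; rewrite /hyperF_q; case: ifPn => [_|/asboolP]; last first.
  case: a => [a _|b []]; last by rewrite NegzE rmorphN; exact: negative_degenerate.
  apply: hypergeometric_gould => m; apply: pochhammer_neq0 => j _.
  by rewrite (_ : (Posz a)%:~R = a%:R :> C) // natr1 -natrD pnatr_eq0.
apply: cvg_lim; first exact: norm_hausdorff.
have cvgW : gould_subseries x w @[x --> (a%:~R : C)^'] --> gould_subseries a%:~R w.
  exact: cvg_within_filter (gould_subseries_continuous w_le).
apply: cvg_trans cvgW.
apply: near_eq_cvg; near=> x; apply/esym/hypergeometric_gould.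
have poch_neq0 : forall m, pochhammer (x + 1) m != 0 by near: x; exact: near_int_pochhammer.
by move=> m; exact: poch_neq0.
Unshelve. all: by end_near. Qed.

End Pochhammer.

(** * Sums over the large roots of a trinomial *)

Section RootsOfUnity.
Variable F : fieldType.

Lemma sum_prim_root q (z : F) k : q.-primitive_root z ->
  \sum_(i < q) (z ^+ i) ^+ k = if (q %| k)%N then q%:R else 0.
Proof.
move=> z_prim; under eq_bigr do rewrite exprAC.
have zq : (z ^+ k) ^+ q = 1 by rewrite exprAC (prim_expr_order z_prim) expr1n.
rewrite (prim_order_dvd z_prim); case: eqP => [->|/eqP zk_neq1].
  by under eq_bigr do rewrite expr1n; rewrite sumr_const card_ord.
apply: (mulfI (x := z ^+ k - 1)); first by rewrite subr_eq0.
by rewrite -subrX1 zq subrr mulr0.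
Qed.

Lemma sum_dvdn q (f : nat -> F) M : (0 < q)%N ->
  \sum_(0 <= k < q * M) (if (q %| k)%N then f k else 0) =
  \sum_(0 <= m < M) f (q * m)%N.
Proof.
move=> q_gt0; elim: M => [|M IHM]; first by rewrite muln0 !big_geq.
rewrite big_nat_recr //= -IHM mulnS addnC.
rewrite (big_cat_nat (n := (q * M)%N)) ?leq_addr //=; congr (_ + _).
rewrite -{1}[(q * M)%N]add0n big_addn addKn big_mkord.
rewrite (bigD1 (Ordinal q_gt0)) //= add0n dvdn_mulr // big1 ?addr0 // => i.
rewrite -val_eqE /= => i_neq0; rewrite dvdn_addl ?dvdn_mulr // ifF //.
by apply/negP => /dvdn_leq; rewrite lt0n i_neq0 leqNgt ltn_ord => /(_ isT).
Qed.

(** X^q - 1 is separable, hence has q distinct roots, and these must include a primitive one. *)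
Lemma exists_prim_root (L : closedFieldType) q : (0 < q)%N -> q%:R != 0 :> L ->
  exists z : L, q.-primitive_root z.
Proof.
move=> q_gt0 q_neq0.
have [rs rsE] := closed_field_poly_normal ('X^q - 1 : {poly L}).
rewrite lead_coefXnsubC // scale1r in rsE.
have rs_uniq : uniq rs by rewrite -separable_prod_XsubC -rsE separable_Xn_sub_1.
have rs_size : size rs = q.
  have := congr1 (fun P : {poly _} => size P) rsE.
  by rewrite size_XnsubC // size_prod_XsubC => -[].
have := @has_prim_root L q rs q_gt0.
have -> : all q.-unity_root rs.
  by apply/allP => x x_rs; rewrite /root_of_unity rsE root_prod_XsubC.
by rewrite rs_size leqnn => /(_ isT rs_uniq isT)/hasP[z _ z_prim]; exists z.
Qed.

End RootsOfUnity.

(** * The hypergeometric function as a power sum of roots *)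

Section Evaluation.
Variable R : realType.
Local Notation C := (cplx R).
Variables p q : nat.
Hypotheses (p_gt0 : (0 < p)%N) (q_gt0 : (0 < q)%N).
Let r : C := - (p%:R / q%:R).
Let K := zeta_factor R p q.

(** Roots-of-unity filter: averaging over t o^i keeps exactly the indices divisible by q. *)
Lemma gould_subseries_sum (a t o : C) (L : 'I_q -> C) : q.-primitive_root o ->
  (forall i : 'I_q, series (gould_term r (- a) (t * o ^+ i)) @ \oo --> L i) ->
  gould_subseries p q a (t ^+ q) = q%:R^-1 * \sum_i L i.
Proof.
move=> o_prim cvgL; have q_neq0 : q%:R != 0 :> C by rewrite pnatr_eq0 -lt0n.
apply: cvg_lim; first exact: norm_hausdorff.
have mulq : (fun M => q * M)%N @ \oo --> \oo.
  move=> A [N _ HN]; exists N => // M /= NM; apply: HN.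
  by rewrite /= (leq_trans NM) // leq_pmull.
(* M terms of the subseries correspond to qM terms of the full series, so the limit is taken along
   multiples of q. *)
rewrite (_ : series _ = fun M => q%:R^-1 *
    \sum_(i < q) series (gould_term r (- a) (t * o ^+ i)) (q * M)%N).
  apply: cvgM; first exact: cvg_cst.
  by apply: cvg_sum_complex => i; exact: (cvg_comp _ _ mulq (cvgL i)).
apply/funext => M; apply: (mulfI q_neq0); rewrite mulrA divff // mul1r.
rewrite /series /= exchange_big /= mulr_sumr.
transitivity (\sum_(0 <= m < M) (fun k => q%:R * (gould r (- a) k * t ^+ k)) (q * m)%N).
  by apply: eq_bigr => m _; rewrite exprM.
rewrite -(sum_dvdn (fun k => q%:R * (gould r (- a) k * t ^+ k))) //; apply: eq_bigr => k _.
transitivity (gould r (- a) k * t ^+ k * \sum_(i < q) (o ^+ i) ^+ k).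
  by rewrite sum_prim_root //; case: ifP => _; rewrite ?mulr0 // mulrC.
by rewrite mulr_sumr; apply: eq_bigr => i _; rewrite /gould_term exprMn mulrA.
Qed.

(** The product of 1 - y over all q-th roots y of g is 1 - g, so some factor satisfies the bound.
    This selects a q-th root near 1 without a branch of the logarithm. *)
Lemma root_near (g : C) : exists y : C, y ^+ q = g /\ `|1 - y| ^+ q <= `|1 - g|.
Proof.
have [->|g_neq1] := eqVneq g 1.
  by exists 1; rewrite expr1n subrr normr0 expr0n eqn0Ngt q_gt0.
have [rs rsE] := closed_field_poly_normal ('X^q - g%:P : {poly C}).
rewrite lead_coefXnsubC // scale1r in rsE.
have rs_size : size rs = q.
  have := congr1 (fun P : {poly _} => size P) rsE.
  by rewrite size_XnsubC // size_prod_XsubC => -[].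
have prodE : \prod_(y <- rs) (1 - y) = 1 - g.
  transitivity (('X^q - g%:P).[1] : C).
    by rewrite rsE horner_prod; apply: eq_bigr => y _; rewrite hornerXsubC.
  by rewrite hornerD hornerN hornerC hornerXn expr1n.
have /hasP[y y_rs y_le] : has (fun y => `|1 - y| ^+ q <= `|1 - g|) rs.
  rewrite -[has _ _]negbK -all_predC; apply/negP => /allP rs_gt.
  have : \prod_(y <- rs | y \in rs) `|1 - g| < \prod_(y <- rs | y \in rs) `|1 - y| ^+ q.
    apply: ltr_prod => [|y y_rs].
      apply/hasP; case: (rs) rs_size => [q0|y s _]; first by have := q_gt0; rewrite -q0.
      by exists y; rewrite mem_head.
    rewrite normr_ge0 /= real_ltNge ?rs_gt ?ger0_real ?exprn_ge0 //.
    exact: rs_gt.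
  rewrite -!big_seq big_const_seq count_predT rs_size iter_mulr_1 prodrXl -normr_prod prodE.
  by rewrite ltxx.
exists y; split => //; apply/eqP; rewrite -subr_eq0.
have : root ('X^q - g%:P) y by rewrite rsE root_prod_XsubC.
by rewrite /root hornerD hornerN hornerC hornerXn.
Qed.

(** With h^q = g and h near 1, the numbers y_i = x_i / (z^i h) tend to 1 and satisfy y_i^n = y_i^p +
    t o^i for t = b / h^n and o = z^(-n), n = p + q. The branch lemma applies to each y_i, and y_i^q
    = x_i^q / g. An arbitrary filter is allowed so that the result serves both the curves for q > 1
    and the line for q = 1. *)
Lemma hyperF_q_roots (T : Type) (F : set_system T) (FF : Filter F)
    (g b : T -> C) (x : T -> 'I_q -> C) (z : C) (a : int) :
  coprime p q -> q.-primitive_root z ->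
  g @ F --> (1 : C) -> b @ F --> (0 : C) ->
  (forall i, x u i @[u --> F] --> z ^+ i) ->
  \forall u \near F, (forall i, x u i ^+ (p + q) = g u * x u i ^+ p + b u) ->
    hyperF_q p q a%:~R (K * (b u ^+ q / g u ^+ (p + q))) =
    q%:R^-1 * \sum_i (x u i ^+ q / g u) ^ (- a).
Proof.
move=> pq_coprime z_prim cvgg cvgb cvgx.
pose h u := projT1 (cid (root_near (g u))).
have hP u : h u ^+ q = g u /\ `|1 - h u| ^+ q <= `|1 - g u|.
  by rewrite /h; case: cid.
have z_neq0 i : z ^+ i != 0.
  rewrite expf_neq0 //; apply/eqP => z0; have := prim_expr_order z_prim.
  by rewrite z0 expr0n eqn0Ngt q_gt0 => /eqP; rewrite eq_sym oner_eq0.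
have cvgh : h @ F --> (1 : C).
  apply/cvgrPdist_lt => e e_gt0; have eq_gt0 : 0 < e ^+ q by rewrite exprn_gt0.
  have gE : \forall u \near F, `|1 - g u| < e ^+ q by exact: cvgr_dist_lt cvgg _ eq_gt0.
  near=> u; rewrite -(ltr_pXn2r q_gt0) ?nnegrE ?normr_ge0 ?ltW //.
  apply: le_lt_trans (hP u).2 _; near: u; exact: gE.
have cvgy i : x u i / (z ^+ i * h u) @[u --> F] --> (1 : C).
  rewrite (_ : 1 = z ^+ i / (z ^+ i * 1)); last by rewrite mulr1 divff.
  apply: cvgM; first exact: cvgx.
  apply: cvgV; first by rewrite mulr1.
  exact: cvgM (cvg_cst _) cvgh.
have branch_near : \forall u \near F, forall i : 'I_q, forall t,
    (x u i / (z ^+ i * h u)) ^+ (p + q) = (x u i / (z ^+ i * h u)) ^+ p + t ->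
    forall a : int, series (gould_term r a%:~R t) @ \oo --> ((x u i / (z ^+ i * h u)) ^+ q) ^ a.
  apply: filter_forall => i.
  exact: (cvgy i _ (gould_series_branch R p q_gt0)).
have cvgw : b u ^+ q / g u ^+ (p + q) @[u --> F] --> (0 : C).
  rewrite (_ : 0 = 0 ^+ q / 1 ^+ (p + q)); last by rewrite expr0n eqn0Ngt q_gt0 mul0r.
  have cvgbq := @cvgX_complex _ _ _ FF _ _ q cvgb.
  have cvggn := @cvgX_complex _ _ _ FF _ _ (p + q) cvgg.
  apply: cvgM cvgbq (cvgV _ cvggn).
  by rewrite expf_neq0 // oner_neq0.
have d_gt0 : 0 < (2 ^- p.+3) ^+ q :> C by rewrite exprn_gt0 // invr_gt0 exprn_gt0.
near=> u => xE.
have w_le : `|b u ^+ q / g u ^+ (p + q)| <= (2 ^- p.+3) ^+ q.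
  rewrite -normrN -sub0r ltW //; near: u; exact: cvgr_dist_lt cvgw _ d_gt0.
have h_neq0 : h u != 0 by near: u; exact: cvgr_neq0 cvgh (oner_neq0 _).
have [hq _] := hP u.
rewrite hyperF_q_gould //.
have wE : b u ^+ q / g u ^+ (p + q) = (b u / h u ^+ (p + q)) ^+ q.
  by rewrite exprMn exprVn -exprM mulnC exprM hq.
(* This is z^(-(p+q)) with a natural exponent. It is primitive because q - 1 and p + q are coprime
   to q. *)
pose o := z ^+ (q.-1 * (p + q)).
have o_prim : q.-primitive_root o.
  rewrite prim_root_exp_coprime // coprimeMl coprimePn // coprime_sym /coprime.
  by rewrite gcdnDr -/(coprime q p) coprime_sym.
have on : o * z ^+ (p + q) = 1.
  by rewrite /o -exprD -mulSnr prednK // exprM (prim_expr_order z_prim) expr1n.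
have oE i : o ^+ i = ((z ^+ i) ^+ (p + q))^-1.
  by apply/esym/mulr1_eq; rewrite exprAC -exprMn mulrC on expr1n.
rewrite wE; apply: (gould_subseries_sum o_prim) => i.
have br : forall i : 'I_q, forall t,
    (x u i / (z ^+ i * h u)) ^+ (p + q) = (x u i / (z ^+ i * h u)) ^+ p + t ->
    forall a : int, series (gould_term r a%:~R t) @ \oo --> ((x u i / (z ^+ i * h u)) ^+ q) ^ a.
  by near: u.
have -> : x u i ^+ q / g u = (x u i / (z ^+ i * h u)) ^+ q.
  by rewrite exprMn exprVn exprMn exprAC (prim_expr_order z_prim) expr1n mul1r hq.
rewrite -mulrNz; apply: br.
rewrite oE !exprMn !exprVn !exprMn xE -hq mulrDl; congr (_ + _); last first.
  by rewrite invfM mulrCA mulrA [X in X * _]mulrC; ring.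
have cq : (z ^+ i) ^+ q = 1 by rewrite exprAC (prim_expr_order z_prim) expr1n.
rewrite !exprD cq mulr1.
have := expf_neq0 p (z_neq0 i); have := expf_neq0 p h_neq0; have := expf_neq0 q h_neq0.
set c := (_ ^+ _) ^+ _; set hp := h u ^+ p; set hq' := h u ^+ q => hq0 hp0 c0.
by field; rewrite c0 hp0 hq0.
Unshelve. all: by end_near. Qed.

End Evaluation.

(** * Forms and rational functions on Schwarz curves *)

Section Forms.
Variables (R : realType) (k : nat).
Local Notation C := (cplx R).
Implicit Types (E : 'rV[C]_k -> C) (d e : nat).

(** Phrased on functions, so that forms can be built by closure rules without handling packed
    homogeneous polynomials. *)
Definition is_form d E : Prop :=
  exists P : mpoly.dhomog k C d, forall x, form_eval P x = E x.

Lemma is_form_coord (i : 'I_k) : is_form 1 (fun x => x 0 i).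
Proof.
have homX : mpoly.mpolyX C (mpoly.mnm1 i) \is
    mpoly.ishomog1 1 (mpoly.mpoly_mdeg__canonical__mpoly_Measure k).
  by rewrite mpoly.dhomogX; apply/eqP; exact: mpoly.mdeg1.
by exists (mpoly.DHomog homX) => x; rewrite /form_eval /= mpoly.mevalXU.
Qed.

Lemma is_form0 d : is_form d (fun=> 0).
Proof.
exists (mpoly.DHomog (mpoly.dhomog0 _ _ d)) => x.
by rewrite /form_eval /= mpoly.meval0.
Qed.

Lemma is_form_cst (c : C) : is_form 0 (fun=> c).
Proof.
exists (mpoly.DHomog (mpoly.dhomogZ c (mpoly.dhomog1 _ _))) => x.
by rewrite /form_eval /= mpoly.mevalZ mpoly.meval1 mulr1.
Qed.

Lemma is_formD d E1 E2 : is_form d E1 -> is_form d E2 ->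
  is_form d (fun x => E1 x + E2 x).
Proof.
move=> [[P homP] PE] [[Q homQ] QE].
exists (mpoly.DHomog (mpoly.dhomogD homP homQ)) => x.
by rewrite /form_eval /= mpoly.mevalD -PE -QE.
Qed.

Lemma is_formM d e E1 E2 : is_form d E1 -> is_form e E2 ->
  is_form (d + e) (fun x => E1 x * E2 x).
Proof.
move=> [[P homP] PE] [[Q homQ] QE].
exists (mpoly.DHomog (mpoly.dhomogM homP homQ)) => x.
by rewrite /form_eval /= mpoly.mevalM -PE -QE.
Qed.

Lemma is_formZ d E (c : C) : is_form d E -> is_form d (fun x => c * E x).
Proof. by move=> formE; exact: is_formM (is_form_cst c) formE. Qed.

Lemma is_formB d E1 E2 : is_form d E1 -> is_form d E2 ->
  is_form d (fun x => E1 x - E2 x).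
Proof.
move=> form1 form2.
rewrite (_ : (fun x => _) = fun x => E1 x + -1 * E2 x).
  exact: is_formD form1 (is_formZ (-1) form2).
by apply/funext => x; rewrite mulN1r.
Qed.

Lemma is_formX d E m : is_form d E -> is_form (d * m) (fun x => E x ^+ m).
Proof.
move=> formE; elim: m => [|m IHm]; first by rewrite muln0; exact: is_form_cst.
rewrite mulnS (_ : (fun x => _) = fun x => E x * E x ^+ m).
  exact: is_formM formE IHm.
by apply/funext => x; rewrite exprS.
Qed.

Lemma is_form_sum d (I : Type) (s : seq I) (E : I -> 'rV[C]_k -> C) :
  (forall i, is_form d (E i)) -> is_form d (fun x => \sum_(i <- s) E i x).
Proof.
move=> formE; elim: s => [|i s IHs].
  rewrite (_ : (fun x => _) = fun=> 0); first exact: is_form0.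
  by apply/funext => x; rewrite big_nil.
rewrite (_ : (fun x => _) = fun x => E i x + \sum_(j <- s) E j x).
  exact: is_formD (formE i) IHs.
by apply/funext => x; rewrite big_cons.
Qed.

Lemma is_form_prod (I : Type) (s : seq I) (P : pred I) (d : I -> nat)
    (E : I -> 'rV[C]_k -> C) :
  (forall i, is_form (d i) (E i)) ->
  is_form (\sum_(i <- s | P i) d i) (fun x => \prod_(i <- s | P i) E i x).
Proof.
move=> formE; elim: s => [|i s IHs].
  rewrite big_nil (_ : (fun x => _) = fun=> 1); first exact: is_form_cst.
  by apply/funext => x; rewrite big_nil.
rewrite big_cons (_ : (fun x => _) =
    fun x => (if P i then E i x else 1) * \prod_(j <- s | P j) E j x).
  case: (P i); first exact: is_formM (formE i) IHs.
  exact: is_formM (is_form_cst 1) IHs.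
by apply/funext => x; rewrite big_cons; case: (P i); rewrite // mul1r.
Qed.

End Forms.

(** * A criterion for uniformization by the symmetric quotient *)

Section SchwarzUniformization.
Variables (R : realType) (p q k : nat).
Local Notation C := (cplx R).
Local Notation n := (p + q)%N.
Implicit Types (x c : 'rV[C]_k).

Lemma schwarz_locus_curve : @schwarz_locus R p q k `<=` @schwarz_curve R p q k.
Proof. by move=> x x_locus; split=> [|d P P0]; [case: x_locus | exact: P0]. Qed.

(** Retains from [roots_of_trinomial] only that each entry is a root, which is all that the formulas
    on the curve use. *)
Definition solves_trinomial (g b : C) x : Prop :=
  forall i, x 0 i ^+ n = g * x 0 i ^+ p + b.

Lemma roots_of_trinomialE g b x :
  roots_of_trinomial p q g b x -> solves_trinomial g b x.
Proof.
case=> r [j [rE _ xE]] i; have : root (trinomial p q g b) (x 0 i).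
  rewrite rE xE /root horner_prod; apply/prodf_eq0; exists (j i) => //.
  by rewrite hornerXsubC subrr.
rewrite /root /trinomial !hornerE => /eqP /(canRL (subrK _)).
by rewrite add0r => /(canRL (subrK _)); rewrite addrC.
Qed.

(* Symmetry of N / D need only be checked on the locus: cross-multiplied, it is
   the vanishing of a form, which extends to the Zariski closure. *)
Lemma uniformized_by_symmI (N D : 'rV[C]_k -> C) d (base : set_system C) (F : C -> C) c :
  (1 < k)%N ->
  (forall s : {perm 'I_k}, is_form d (fun x => N (col_perm s x)) /\
                           is_form d (fun x => D (col_perm s x))) ->
  (forall (s : {perm 'I_k}) x g b, g != 0 \/ b != 0 -> solves_trinomial g b x ->
    N (col_perm s x) * D x = N x * D (col_perm s x)) ->
  @schwarz_locus R p q k c -> D c != 0 ->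
  (forall U, base U -> \forall x \near c, forall g b : C, g != 0 -> solves_trinomial g b x ->
    U (zeta_factor R p q * (b ^+ q / g ^+ n))) ->
  (\forall x \near c, forall g b : C, g != 0 -> D x != 0 -> solves_trinomial g b x ->
    N x / D x = F (zeta_factor R p q * (b ^+ q / g ^+ n))) ->
  uniformized_by_symm p q k base F.
Proof.
move=> k_gt1 formND inv c_locus Dc_neq0 over agree.
rewrite /uniformized_by_symm gtn_eqF //.
have perm1 x : col_perm 1%g x = x by apply/matrixP => i j; rewrite mxE perm1.
have [[Np NpE] [Dp DpE]] := formND 1%g.
have {}NpE x : form_eval Np x = N x by rewrite NpE perm1.
have {}DpE x : form_eval Dp x = D x by rewrite DpE perm1.
have den_neq0 : exists2 x, schwarz_curve p q x & form_eval Dp x != 0.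
  by exists c; [exact: schwarz_locus_curve | rewrite DpE].
exists (RatFun Np den_neq0), c; split => /=.
- move=> s _ x x_curve /=; rewrite !NpE !DpE; apply/eqP; rewrite -subr_eq0; apply/eqP.
  have [formNs formDs] := formND s.
  have formN : is_form d N by exists Np.
  have formD : is_form d D by exists Dp.
  have [P PE] := is_formB (is_formM formNs formD) (is_formM formN formDs).
  case: x_curve => _ /(_ _ P); rewrite PE; apply => y [_ [g [b [gb y_roots]]]].
  rewrite PE; apply/eqP; rewrite subr_eq0; apply/eqP.
  exact: inv gb (roots_of_trinomialE y_roots).
- split; first exact: schwarz_locus_curve.
  move=> U /over; apply: filterS => x Ux z _ [g [b [g_neq0 /roots_of_trinomialE xE ->]]].
  exact: Ux.
- move: agree; apply: filterS => x Fx z _ [g [b [g_neq0 /roots_of_trinomialE xE ->]]].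
  by rewrite NpE DpE => Dx_neq0; exact: Fx.
Qed.

End SchwarzUniformization.

(** * Recovering g and b from two roots *)

Section TwoRoots.
Variables (R : realType) (p q k : nat).
Local Notation C := (cplx R).
Local Notation n := (p + q)%N.
Variables (i0 i1 : 'I_k).
Implicit Types (x c : 'rV[C]_k) (s : {perm 'I_k}).

(* Eliminating b, resp. g, from x_i^n = g x_i^p + b at i = i0, i1 recovers
   g = slope_at x and b = const_at x. *)
Definition dpow d x : C := x 0 i0 ^+ d - x 0 i1 ^+ d.

Definition dcross x : C := x 0 i1 ^+ n * x 0 i0 ^+ p - x 0 i0 ^+ n * x 0 i1 ^+ p.

Definition slope_at x : C := dpow n x / dpow p x.

Definition const_at x : C := dcross x / dpow p x.

Lemma dpow_slope g b x : solves_trinomial p q g b x -> dpow n x = g * dpow p x.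
Proof. by move=> xE; rewrite /dpow !xE; ring. Qed.

Lemma dcross_const g b x : solves_trinomial p q g b x -> dcross x = b * dpow p x.
Proof. by move=> xE; rewrite /dcross /dpow !xE; ring. Qed.

Lemma solves_slope g b x : dpow p x != 0 -> solves_trinomial p q g b x -> slope_at x = g.
Proof. by move=> D0 xE; rewrite /slope_at (dpow_slope xE) mulfK. Qed.

Lemma solves_const g b x : dpow p x != 0 -> solves_trinomial p q g b x -> const_at x = b.
Proof. by move=> D0 xE; rewrite /const_at (dcross_const xE) mulfK. Qed.

Lemma is_form_coord_perm s i : is_form 1 (fun x => col_perm s x 0 i).
Proof.
rewrite (_ : (fun x => _) = fun x => x 0 (s i)); first exact: is_form_coord.
by apply/funext => x; rewrite mxE.
Qed.

Lemma is_form_coordX s i d : is_form d (fun x => col_perm s x 0 i ^+ d).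
Proof. by have := is_formX d (is_form_coord_perm s i); rewrite mul1n. Qed.

Lemma is_form_dpow s d : is_form d (fun x => dpow d (col_perm s x)).
Proof. exact: is_formB (is_form_coordX s i0 d) (is_form_coordX s i1 d). Qed.

Lemma is_form_dcross s : is_form (n + p) (fun x => dcross (col_perm s x)).
Proof.
apply: is_formB; first exact: is_formM (is_form_coordX s i1 n) (is_form_coordX s i0 p).
exact: is_formM (is_form_coordX s i0 n) (is_form_coordX s i1 p).
Qed.

Lemma cvg_coord c i : (fun x : 'rV[C]_k => x 0 i) @ c --> c 0 i.
Proof. exact: coord_continuous. Qed.

Lemma cvg_coordX c i d : (fun x : 'rV[C]_k => x 0 i ^+ d) @ c --> c 0 i ^+ d.
Proof. exact: cvgX_complex (@cvg_coord c i). Qed.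

Lemma cvg_dpow c d : dpow d x @[x --> c] --> dpow d c.
Proof. exact: cvgB (@cvg_coordX c i0 d) (@cvg_coordX c i1 d). Qed.

Lemma cvg_dcross c : dcross x @[x --> c] --> dcross c.
Proof.
exact: cvgB (cvgM (@cvg_coordX c i1 n) (@cvg_coordX c i0 p))
  (cvgM (@cvg_coordX c i0 n) (@cvg_coordX c i1 p)).
Qed.

Lemma cvg_slope_at c : dpow p c != 0 -> slope_at x @[x --> c] --> slope_at c.
Proof. by move=> D0; exact: cvgM (@cvg_dpow c n) (cvgV D0 (@cvg_dpow c p)). Qed.

Lemma cvg_const_at c : dpow p c != 0 -> const_at x @[x --> c] --> const_at c.
Proof. by move=> D0; exact: cvgM (@cvg_dcross c) (cvgV D0 (@cvg_dpow c p)). Qed.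

Lemma near_dpow_neq0 c : dpow p c != 0 -> \forall x \near c, dpow p x != 0.
Proof. by move=> D0; exact: cvgr_neq0 (@cvg_dpow c p) D0. Qed.

End TwoRoots.

(** * Part (i), q > 1 *)

Section LargeRoots.
Variables (R : realType) (p q : nat).
Local Notation C := (cplx R).
Local Notation n := (p + q)%N.
Hypotheses (p_gt0 : (0 < p)%N) (q_gt1 : (1 < q)%N) (coprime_pq : coprime p q).
Implicit Types (x : 'rV[C]_q) (s : {perm 'I_q}).
Let q_gt0 : (0 < q)%N := ltnW q_gt1.
Let i0 : 'I_q := Ordinal q_gt0.
Let i1 : 'I_q := Ordinal q_gt1.

(** The base points: for m = q it corresponds to g = 1, b = 0, over zeta = 0; for m = p + q to g =
    0, b = 1, over zeta = infinity. *)
Definition prim_row m (z : C) : 'rV[C]_m := \row_i z ^+ i.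

(** At g = 1, b = 0 the trinomial is x^p (x^q - 1): p roots vanish, and the entries are the q
    others. *)
Lemma prim_row_locus_q z : q.-primitive_root z ->
  @schwarz_locus R p q q (prim_row q z).
Proof.
move=> z_prim; split.
  apply/eqP => /matrixP/(_ 0 i0); rewrite !mxE expr0 => /eqP.
  by rewrite oner_eq0.
exists 1, 0; split; first by left; exact: oner_neq0.
exists (fun i => match fintype.split i with inl _ => 0 | inr j => z ^+ j end), (@rshift p q).
split; [|exact: rshift_inj|].
  rewrite big_split_ord /=.
  under eq_bigr => i _ do rewrite (unsplitK (inl _ i)) subr0.
  under [X in _ = _ * X]eq_bigr => i _ do rewrite (unsplitK (inr _ i)).
  rewrite prodr_const card_ord.
  have := factor_Xn_sub_1 z_prim; rewrite big_mkord => ->.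
  by rewrite /trinomial scale1r subr0 exprD mulrBr mulr1.
by move=> i; rewrite mxE (unsplitK (inr _ i)).
Qed.

(** Vanishing would mean z^p = 1, that is q | p, against coprimality and q > 1. *)
Lemma dpow_prim_row z : q.-primitive_root z -> dpow i0 i1 p (prim_row q z) != 0.
Proof.
move=> z_prim; rewrite /dpow !mxE expr0 expr1n expr1 subr_eq0 eq_sym.
rewrite -(prim_order_dvd z_prim); apply/negP => /gcdn_idPr gcdE.
by move: coprime_pq; rewrite /coprime gcdE gtn_eqF.
Qed.

Let K := zeta_factor R p q.

(** The elementary symmetric function of degree q - 1 in the x_j^e: the numerator of the sum of the
    x_j^(-e) over their common denominator. *)
Definition esym_power e x : C := \sum_i \prod_(j | j != i) x 0 j ^+ e.

Lemma esym_power_perm e s x : esym_power e (col_perm s x) = esym_power e x.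
Proof.
rewrite /esym_power [RHS](reindex_inj (@perm_inj _ s)) /=; apply: eq_bigr => i _.
rewrite [RHS](reindex_inj (@perm_inj _ s)) /=; apply: eq_big => [j|j _].
  by rewrite (inj_eq perm_inj).
by rewrite mxE.
Qed.

Lemma prod_perm e s x : \prod_j col_perm s x 0 j ^+ e = \prod_j x 0 j ^+ e.
Proof.
rewrite [RHS](reindex_inj (@perm_inj _ s)) /=; apply: eq_bigr => i _.
by rewrite mxE.
Qed.

Lemma sum_perm e s x : \sum_j col_perm s x 0 j ^+ e = \sum_j x 0 j ^+ e.
Proof.
rewrite [RHS](reindex_inj (@perm_inj _ s)) /=; apply: eq_bigr => i _.
by rewrite mxE.
Qed.

Lemma is_form_esym s e :
  is_form (q.-1 * e) (fun x => esym_power e (col_perm s x)).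
Proof.
apply: is_form_sum => i.
have -> : (q.-1 * e = \sum_(j < q | j != i) e)%N.
  by rewrite sum_nat_const cardC1 card_ord.
by apply: is_form_prod => j; exact: is_form_coordX.
Qed.

Lemma is_form_prod_coord s e : is_form (q * e) (fun x => \prod_j col_perm s x 0 j ^+ e).
Proof.
have -> : (q * e = \sum_(j < q) e)%N by rewrite sum_nat_const card_ord.
by apply: is_form_prod => j; exact: is_form_coordX.
Qed.

Lemma esym_power_div e x : \prod_j x 0 j ^+ e != 0 ->
  esym_power e x / \prod_j x 0 j ^+ e = \sum_j (x 0 j ^+ e)^-1.
Proof.
move=> prod_neq0; rewrite mulr_suml; apply: eq_bigr => i _.
rewrite [in X in _ / X](bigD1 i) //= invfM mulrCA mulfV ?mulr1 //.
by move: prod_neq0; rewrite (bigD1 i) //= mulf_eq0 negb_or => /andP[].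
Qed.

Section NearPrimitive.
Variables (z : C) (z_prim : q.-primitive_root z).
Let c := prim_row q z.

Lemma prim_rowX i : c 0 i ^+ n = c 0 i ^+ p.
Proof.
by rewrite exprD mxE [_ ^+ q]exprAC (prim_expr_order z_prim) expr1n mulr1.
Qed.

Lemma slope_at_prim_row : slope_at p q i0 i1 c = 1.
Proof.
rewrite /slope_at; have -> : dpow i0 i1 n c = dpow i0 i1 p c by rewrite /dpow !prim_rowX.
by rewrite divff // dpow_prim_row.
Qed.

Lemma const_at_prim_row : const_at p q i0 i1 c = 0.
Proof. by rewrite /const_at /dcross !prim_rowX [X in X - _]mulrC subrr mul0r. Qed.

Lemma near_power_sum (a : int) : \forall x \near c, forall g b : C, g != 0 ->
  solves_trinomial p q g b x ->
  hyperF_q p q a%:~R (K * (b ^+ q / g ^+ n)) = q%:R^-1 * \sum_i (x 0 i ^+ q / g) ^ (- a).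
Proof.
have D0 : dpow i0 i1 p c != 0 by exact: dpow_prim_row.
have cvgg : slope_at p q i0 i1 x @[x --> c] --> (1 : C).
  by rewrite -slope_at_prim_row; exact: cvg_slope_at.
have cvgb : const_at p q i0 i1 x @[x --> c] --> (0 : C).
  by rewrite -const_at_prim_row; exact: cvg_const_at.
have cvgx (i : 'I_q) : x 0 i @[x --> c] --> z ^+ i.
  by have := @cvg_coord R q c i; rewrite [c 0 i]mxE.
have := hyperF_q_roots p_gt0 q_gt0 (nbhs_filter c) a coprime_pq z_prim cvgg cvgb cvgx.
move=> nearF; near=> x => g b g0 xE.
have Dx : dpow i0 i1 p x != 0 by near: x; exact: near_dpow_neq0.
(* The general evaluation needs g and b as functions of the point; near the base point they are
   [slope_at] and [const_at]. *)
have gE := solves_slope Dx xE; have bE := solves_const Dx xE.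
rewrite -gE -bE; move: (xE); rewrite /solves_trinomial -{1}gE -{1}bE.
by near: x.
Unshelve. all: by end_near. Qed.

Lemma near_zeta0 U : nbhs (0 : C) U -> \forall x \near c, forall g b : C, g != 0 ->
  solves_trinomial p q g b x -> U (K * (b ^+ q / g ^+ n)).
Proof.
move=> U0.
have D0 : dpow i0 i1 p c != 0 by exact: dpow_prim_row.
have cvgg : slope_at p q i0 i1 x @[x --> c] --> (1 : C).
  by rewrite -slope_at_prim_row; exact: cvg_slope_at.
have cvgb : const_at p q i0 i1 x @[x --> c] --> (0 : C).
  by rewrite -const_at_prim_row; exact: cvg_const_at.
have cvgz : K * (const_at p q i0 i1 x ^+ q / slope_at p q i0 i1 x ^+ n) @[x --> c] --> (0 : C).
  rewrite (_ : 0 = K * (0 ^+ q / 1 ^+ n)); last by rewrite expr0n eqn0Ngt q_gt0 mul0r mulr0.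
  have bq := @cvgX_complex R _ _ (nbhs_filter c) _ _ q cvgb.
  have gn := @cvgX_complex R _ _ (nbhs_filter c) _ _ n cvgg.
  apply: cvgM (cvg_cst _) (cvgM bq (cvgV _ gn)).
  by rewrite expf_neq0 // oner_neq0.
have nearU := cvgz _ U0.
near=> x => g b g0 xE.
have Dx : dpow i0 i1 p x != 0 by near: x; exact: near_dpow_neq0.
by rewrite -(solves_slope Dx xE) -(solves_const Dx xE); near: x.
Unshelve. all: by end_near. Qed.

End NearPrimitive.

(* The function is f = q^-1 g^a sum_i x_i^(-qa), with g = slope_at x. *)
Lemma uniformized_q_gt1 (a : int) :
  uniformized_by_symm p q q (nbhs (0 : C)) (fun w => hyperF_q p q a%:~R w).
Proof.
have q_neq0 : q%:R != 0 :> C by rewrite pnatr_eq0 -lt0n.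
have [z z_prim] := exists_prim_root q_gt0 q_neq0.
have c_locus := prim_row_locus_q z_prim.
have D0 := dpow_prim_row z_prim; have near0 := near_zeta0 z_prim.
have near_sum := near_power_sum z_prim a.
have slope1 := slope_at_prim_row z_prim.
set c := prim_row q z in c_locus D0 near0 near_sum slope1.
have G0 : dpow i0 i1 n c != 0.
  by apply/eqP => G0; move/eqP: slope1; rewrite /slope_at G0 mul0r eq_sym oner_eq0.
have c_neq0 e : \prod_j c 0 j ^+ e != 0.
  apply/prodf_neq0 => j _; rewrite !mxE !expf_neq0 //; apply/eqP => z0.
  have := prim_expr_order z_prim.
  by rewrite z0 expr0n eqn0Ngt q_gt0 => /eqP; rewrite eq_sym oner_eq0.
(* The sign of a decides which factors are denominators. For a = m >= 0 the inverse powers of the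
   roots are brought over a common denominator, and both degrees are nm + (q-1)qm = pm + q(qm), with
   n = p + q. *)
case: a near_sum => m near_sum.
- apply: (@uniformized_by_symmI R p q q
    (fun x => dpow i0 i1 n x ^+ m * esym_power (q * m) x)
    (fun x => q%:R * (dpow i0 i1 p x ^+ m * \prod_j x 0 j ^+ (q * m)))
    (n * m + q.-1 * (q * m)) _ _ c).
  + exact: q_gt1.
  + move=> s; split.
      exact: is_formM (is_formX m (is_form_dpow R i0 i1 s n)) (is_form_esym s _).
    have -> : (n * m + q.-1 * (q * m) = p * m + q * (q * m))%N.
      by rewrite mulnDl -addnA -mulSn prednK.
    apply: is_formZ.
    exact: is_formM (is_formX m (is_form_dpow R i0 i1 s p)) (is_form_prod_coord s _).
  + move=> s x g b _ xE; rewrite esym_power_perm prod_perm.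
    have xsE : solves_trinomial p q g b (col_perm s x) by move=> i; rewrite mxE.
    by rewrite (dpow_slope i0 i1 xE) (dpow_slope i0 i1 xsE) !exprMn; ring.
  + exact: c_locus.
  + by rewrite !mulf_neq0 ?expf_neq0.
  + exact: near0.
  + near=> x => g b g0 den_neq0 xE.
    have -> : hyperF_q p q m%:~R (K * (b ^+ q / g ^+ n)) =
        q%:R^-1 * \sum_i (x 0 i ^+ q / g) ^ (- m%:Z).
      by move: g b g0 {den_neq0} xE; near: x.
    move: den_neq0; rewrite !mulf_eq0 !negb_or => /and3P[_ Dm_neq0 prod_neq0].
    transitivity (q%:R^-1 * g ^+ m * (esym_power (q * m) x / \prod_j x 0 j ^+ (q * m))).
      rewrite (dpow_slope i0 i1 xE) exprMn.
      move: Dm_neq0 prod_neq0; set Dm := _ ^+ m; set P := \prod_j _ => Dm0 P0.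
      by field; rewrite Dm0 P0 q_neq0.
    rewrite esym_power_div // -mulrA; congr (_ * _); rewrite mulr_sumr; apply: eq_bigr => i _.
    by rewrite -invr_expz -exprnP exprMn exprVn invfM invrK -exprM mulrC.
(* For a = -(m+1) the power sum of the roots is itself a form, and g^(m+1) goes to the
   denominator. *)
- apply: (@uniformized_by_symmI R p q q
    (fun x => dpow i0 i1 p x ^+ m.+1 * \sum_j x 0 j ^+ (q * m.+1))
    (fun x => q%:R * dpow i0 i1 n x ^+ m.+1)
    (n * m.+1) _ _ c).
  + exact: q_gt1.
  + move=> s; split; last exact: is_formZ (is_formX m.+1 (is_form_dpow R i0 i1 s n)).
    rewrite mulnDl; apply: is_formM (is_formX m.+1 (is_form_dpow R i0 i1 s p)) _.
    by apply: is_form_sum => i; exact: is_form_coordX.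
  + move=> s x g b _ xE; rewrite sum_perm.
    have xsE : solves_trinomial p q g b (col_perm s x) by move=> i; rewrite mxE.
    by rewrite (dpow_slope i0 i1 xE) (dpow_slope i0 i1 xsE) !exprMn; ring.
  + exact: c_locus.
  + by rewrite !mulf_neq0 ?expf_neq0.
  + exact: near0.
  + near=> x => g b g0 den_neq0 xE.
    have -> : hyperF_q p q (Negz m)%:~R (K * (b ^+ q / g ^+ n)) =
        q%:R^-1 * \sum_i (x 0 i ^+ q / g) ^ (- Negz m).
      by move: g b g0 {den_neq0} xE; near: x.
    move: den_neq0; rewrite mulf_eq0 negb_or => /andP[_].
    rewrite (dpow_slope i0 i1 xE) exprMn mulf_eq0 negb_or => /andP[gm Dm].
    transitivity (q%:R^-1 * (g ^- m.+1 * \sum_j x 0 j ^+ (q * m.+1))).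
      move: gm Dm; set G := g ^+ _; set D := _ ^+ _; set P := \sum_j _ => G1 D1.
      by field; rewrite G1 D1 q_neq0.
    congr (_ * _); rewrite mulr_sumr; apply: eq_bigr => i _.
    by rewrite NegzE opprK -exprnP exprMn exprVn -exprM mulrC.
Unshelve. all: by end_near. Qed.

End LargeRoots.

(** * Part (ii) *)

(** The factor D^(nM) does not depend on m, so it comes out of the sum; what remains depends on g
    and B only and is unchanged when the roots are permuted. *)
Lemma homogeneous_term (F : comNzRingType) (c k g D B : F) n m M : (m <= M)%N ->
  c * k * ((g * D) ^+ n) ^+ m * (B * D ^+ n) ^+ (M - m) =
  (D ^+ n) ^+ M * (c * k * (g ^+ n) ^+ m * B ^+ (M - m)).
Proof.
move=> mM; rewrite !exprMn; move: (D ^+ n) (g ^+ n) => E h.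
have -> : E ^+ M = E ^+ m * E ^+ (M - m) by rewrite -exprD subnKC.
by ring.
Qed.

(** Dehomogenization: with zeta = K Q / G, dividing by Q^M leaves the term c zeta^(-m). *)
Lemma homogeneous_quotient (F : fieldType) (c K G Q : F) m M :
  (m <= M)%N -> K != 0 -> Q != 0 ->
  c * K ^- m * G ^+ m * Q ^+ (M - m) / Q ^+ M = c * ((K * Q / G)^-1) ^+ m.
Proof.
move=> mM K0 Q0; have -> : Q ^+ M = Q ^+ m * Q ^+ (M - m) by rewrite -exprD subnKC.
rewrite !invfM invrK !exprMn !exprVn.
have := expf_neq0 m K0; have := expf_neq0 m Q0; have := expf_neq0 (M - m) Q0.
move: (Q ^+ m) (Q ^+ (M - m)) (K ^+ m) (G ^+ m) => A B E H B0 A0 E0.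
by field; rewrite A0 B0 E0.
Qed.

Section AllRoots.
Variables (R : realType) (p q : nat).
Local Notation C := (cplx R).
Local Notation n := (p + q)%N.
Hypotheses (p_gt0 : (0 < p)%N) (q_gt0 : (0 < q)%N).
Implicit Types (x : 'rV[C]_n) (s : {perm 'I_n}).

Let K := zeta_factor R p q.

Let n_gt0 : (0 < n)%N.
Proof. by rewrite addn_gt0 p_gt0. Qed.

Let n_gt1 : (1 < n)%N.
Proof. by rewrite -addn1 leq_add. Qed.

Let i0 : 'I_n := Ordinal n_gt0.
Let i1 : 'I_n := Ordinal n_gt1.

Definition hyperF_n_coef (a : C) : nat -> C :=
  hypergeometric_term ([seq (- a + j%:R) / p%:R | j <- iota 0 p] ++
     [seq (a + j%:R) / q%:R | j <- iota 0 q])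
    [seq j%:R / n%:R | j <- iota 1 n.-1] 1.

(** By Gauss's formula the upper parameters contribute [pochhammer (- a) (p * m)] and
    [pochhammer a (q * m)]; the first contains the factor 0 when a >= 0, the second when a < 0. *)
Lemma hyperF_n_coef_eq0 (a : int) m : (`|a| < m)%N -> hyperF_n_coef a%:~R m = 0.
Proof.
move=> a_lt; rewrite /hyperF_n_coef /hypergeometric_term big_cat /=.
rewrite !prod_pochhammer_iota0 //.
have poch0 (b l : nat) : (b < l)%N -> pochhammer (- b%:R : C) l = 0.
  by move=> bl; apply/eqP/prodf_eq0; exists (Ordinal bl); rewrite //= addNr.
case: a a_lt => b /= b_lt.
  rewrite (_ : (Posz b)%:~R = b%:R) // poch0 ?mul0r //.
  by apply: leq_trans b_lt _; rewrite leq_pmull.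
rewrite NegzE mulrNz opprK -pmulrn (poch0 b.+1) ?mul0r ?mulr0 ?mul0r //.
by apply: leq_trans b_lt _; rewrite leq_pmull.
Qed.

Lemma hyperF_n_poly (a : int) w :
  hyperF_n p q a%:~R w = \sum_(m < `|a|.+1) hyperF_n_coef a%:~R m * w ^+ m.
Proof.
rewrite /hyperF_n /hypergeometric; apply: cvg_lim; first exact: norm_hausdorff.
apply: cvg_near_cst; exists `|a|.+1 => // N /= aN.
rewrite /series /= (big_cat_nat (n := `|a|.+1)) //= big_mkord.
rewrite [X in _ + X]big_nat_cond [X in _ + X]big1 ?addr0.
  by apply: eq_bigr => m _; rewrite /hyperF_n_coef /hypergeometric_term expr1n mulr1.
move=> m /andP[/andP[am _] _]; have := hyperF_n_coef_eq0 am.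
by rewrite /hyperF_n_coef /hypergeometric_term expr1n mulr1 => ->; rewrite mul0r.
Qed.

Lemma prim_row_locus_n (z : C) : n.-primitive_root z ->
  @schwarz_locus R p q n (prim_row n z).
Proof.
move=> z_prim; split.
  apply/eqP => /matrixP/(_ 0 i0); rewrite !mxE expr0 => /eqP.
  by rewrite oner_eq0.
exists 0, 1; split; first by right; exact: oner_neq0.
exists (fun i => z ^+ i), id; split => //; last by move=> i; rewrite mxE.
have := factor_Xn_sub_1 z_prim; rewrite big_mkord => ->.
by rewrite /trinomial polyC1; congr (_ - _); rewrite scale0r; exact: subr0.
Qed.

Lemma dpow_prim_row_n (z : C) : n.-primitive_root z -> dpow i0 i1 p (prim_row n z) != 0.
Proof.
move=> z_prim; rewrite /dpow !mxE expr0 expr1n expr1 subr_eq0 eq_sym.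
rewrite -(prim_order_dvd z_prim); apply/negP => /(dvdn_leq p_gt0).
by rewrite leqNgt -{1}[p]addn0 ltn_add2l q_gt0.
Qed.

Section NearPrimitiveRoots.
Variables (z : C) (z_prim : n.-primitive_root z).
Let c := prim_row n z.

Lemma prim_row_nX i : c 0 i ^+ n = 1.
Proof. by rewrite mxE exprAC (prim_expr_order z_prim) expr1n. Qed.

Lemma dcross_prim_row : dcross p q i0 i1 c = dpow i0 i1 p c.
Proof. by rewrite /dcross !prim_row_nX !mul1r. Qed.

(** At the base point g tends to 0 and b to 1, so M / zeta tends to 0; once its modulus is below 1,
    |zeta| > M. *)
Lemma near_zeta_infty U : @nbhs_infty R U -> \forall x \near c, forall g b : C, g != 0 ->
  solves_trinomial p q g b x -> U (K * (b ^+ q / g ^+ n)).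
Proof.
move=> [M M_gt0 HM].
have D0 : dpow i0 i1 p c != 0 by exact: dpow_prim_row_n.
have K0 : K != 0 by exact: zeta_factor_neq0.
have cvgg : slope_at p q i0 i1 x @[x --> c] --> (0 : C).
  rewrite (_ : 0 = slope_at p q i0 i1 c); first exact: cvg_slope_at.
  by rewrite /slope_at /dpow !prim_row_nX subrr mul0r.
have cvgb : const_at p q i0 i1 x @[x --> c] --> (1 : C).
  rewrite (_ : 1 = const_at p q i0 i1 c); first exact: cvg_const_at.
  by rewrite /const_at dcross_prim_row divff.
have bq := @cvgX_complex R _ _ (nbhs_filter c) _ _ q cvgb.
have gn := @cvgX_complex R _ _ (nbhs_filter c) _ _ n cvgg.
have cvgr : M * (slope_at p q i0 i1 x ^+ n / (K * const_at p q i0 i1 x ^+ q))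
    @[x --> c] --> (0 : C).
  rewrite (_ : 0 = M * (0 ^+ n / (K * 1 ^+ q))); last first.
    by rewrite expr0n eqn0Ngt n_gt0 mul0r mulr0.
  apply: cvgM (cvg_cst _) (cvgM gn (cvgV _ (cvgM (cvg_cst _) bq))).
  by rewrite expr1n mulr1.
near=> x => g b g0 xE.
have Dx : dpow i0 i1 p x != 0 by near: x; exact: near_dpow_neq0.
have gE := solves_slope Dx xE; have bE := solves_const Dx xE.
have b0 : b != 0.
  rewrite -bE; near: x; exact: cvgr_neq0 cvgb (oner_neq0 _).
have : `|0 - M * (g ^+ n / (K * b ^+ q))| < 1.
  by rewrite -gE -bE; near: x; apply: cvgr_dist_lt cvgr _ _; exact: ltr01.
rewrite sub0r normrN normrM (gtr0_norm M_gt0) => lt1; apply: HM.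
have kb0 : K * b ^+ q != 0 by rewrite mulf_neq0 ?expf_neq0.
have gn0 : g ^+ n != 0 by rewrite expf_neq0.
rewrite normf_div in lt1.
rewrite [K * _]mulrA normf_div ltr_pdivlMr ?normr_gt0 //.
rewrite -normr_gt0 in kb0; move: lt1.
by rewrite mulrA ltr_pdivrMr // mul1r.
Unshelve. all: by end_near. Qed.

End NearPrimitiveRoots.

Lemma uniformized_n (a : int) :
  uniformized_by_symm p q n (@nbhs_infty R) (fun w => hyperF_n p q a%:~R w^-1).
Proof.
have nC_neq0 : n%:R != 0 :> C by rewrite pnatr_eq0 -lt0n.
have [z z_prim] := exists_prim_root n_gt0 nC_neq0.
have K0 : K != 0 by exact: zeta_factor_neq0.
have D0 := dpow_prim_row_n z_prim.
(* With D = [dpow i0 i1 p x], this is b^q D^n, matching g^n D^n = [dpow i0 i1 n x ^+ n]. Both have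
   degree n^2 and zeta = K Q / (g^n D^n). *)
pose Q x := dcross p q i0 i1 x ^+ q * dpow i0 i1 p x ^+ p.
have QE g b y : solves_trinomial p q g b y -> Q y = b ^+ q * dpow i0 i1 p y ^+ n.
  move=> yE; rewrite /Q (dcross_const i0 i1 yE) exprMn exprD -mulrA.
  by congr (_ * _); rewrite mulrC.
pose M := `|a|.+1.
(* The terminating series in 1/zeta, homogenized over the common denominator Q^M; its indices m < M
   keep the exponents M - m positive. *)
apply: (@uniformized_by_symmI R p q n
  (fun x => \sum_(m < M) hyperF_n_coef a%:~R m * K ^- m *
              (dpow i0 i1 n x ^+ n) ^+ m * Q x ^+ (M - m))
  (fun x => Q x ^+ M) (n * n * M) _ _ (prim_row n z)).
- exact: n_gt1.
- move=> s.
  have formQ : is_form (n * n) (fun x => Q (col_perm s x)).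
    have -> : (n * n = (n + p) * q + p * p)%N by ring.
    exact: is_formM (is_formX q (is_form_dcross R p q i0 i1 s))
      (is_formX p (is_form_dpow R i0 i1 s p)).
  split; last exact: is_formX.
  apply: is_form_sum => m.
  have -> : (n * n * M = n * n * m + n * n * (M - m))%N.
    by rewrite -mulnDr subnKC // ltnW.
  apply: is_formM; last exact: is_formX.
  exact: is_formZ (is_formX m (is_formX n (is_form_dpow R i0 i1 s n))).
- move=> s x g b _ xE.
  have xsE : solves_trinomial p q g b (col_perm s x) by move=> i; rewrite mxE.
  have numE y : solves_trinomial p q g b y ->
      \sum_(m < M) hyperF_n_coef a%:~R m * K ^- m *
        (dpow i0 i1 n y ^+ n) ^+ m * Q y ^+ (M - m) =
      (dpow i0 i1 p y ^+ n) ^+ M *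
      \sum_(m < M) hyperF_n_coef a%:~R m * K ^- m * (g ^+ n) ^+ m * (b ^+ q) ^+ (M - m).
    move=> yE; rewrite mulr_sumr; apply: eq_bigr => m _.
    rewrite (QE _ _ _ yE) (dpow_slope i0 i1 yE).
    by rewrite homogeneous_term // ltnW.
  rewrite (numE _ xE) (numE _ xsE) (QE _ _ _ xE) (QE _ _ _ xsE).
  move: (\sum_(m < M) _) (dpow _ _ _ x ^+ n) (dpow _ _ _ _ ^+ n) => e D1 D2.
  by rewrite !exprMn; ring.
- exact: prim_row_locus_n.
- by rewrite expf_neq0 // /Q dcross_prim_row // mulf_neq0 ?expf_neq0.
- exact: near_zeta_infty.
- near=> x => g b g0 Q_neq0 xE; rewrite hyperF_n_poly mulr_suml.
  have {}Q_neq0 : Q x != 0 by move: Q_neq0; rewrite expf_eq0.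
  apply: eq_bigr => m _; rewrite homogeneous_quotient //; last by rewrite ltnW.
  congr (_ * (_^-1) ^+ _).
  have Dn : dpow i0 i1 p x ^+ n != 0.
    by apply/eqP => Dn; move/eqP: Q_neq0; rewrite (QE _ _ _ xE) Dn mulr0.
  rewrite (QE _ _ _ xE) (dpow_slope i0 i1 xE) [(g * _) ^+ n]exprMn.
  by rewrite [K * (_ * _)]mulrA -mulf_div divff // mulr1 -mulrA.
Unshelve. all: by end_near. Qed.

End AllRoots.

(** * Part (i), q = 1 *)

Section OneRoot.
Variables (R : realType) (p : nat).
Local Notation C := (cplx R).
Hypothesis (p_gt0 : (0 < p)%N).
Let K := zeta_factor R p 1.

(* On P^1_s the root of y^(p+1) = y^p + b near 1 is y = 1 / (1 - s), for
   b = s / (1 - s)^(p+1), so that f = (1 - s)^a. *)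
Lemma uniformized_q_eq1 (a : int) :
  uniformized_by_symm p 1 1 (nbhs (0 : C)) (fun w => hyperF_q p 1 a%:~R w).
Proof.
rewrite /uniformized_by_symm eqxx.
(* The point [0 : 1], that is s = 0, lying over zeta = 0. *)
pose c : 'rV[C]_2 := \row_i (i == 1)%:R.
have c0 : c 0 0 = 0 by rewrite mxE.
have c1 : c 0 1 = 1 by rewrite mxE.
have c_neq0 : @line_s R c.
  by apply/eqP => /matrixP/(_ 0 1); rewrite c1 mxE => /eqP; rewrite oner_eq0.
pose S (x : 'rV[C]_2) := x 0 0 / x 0 1.
have cvgS : S x @[x --> c] --> (0 : C).
  have -> : 0 = c 0 0 / c 0 1 by rewrite c0 mul0r.
  apply: cvgM (@cvg_coord R 2 c 0) (cvgV _ (@cvg_coord R 2 c 1)).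
  by rewrite c1 oner_neq0.
have cvgS1 : (1 - S x) @[x --> c] --> (1 : C).
  by rewrite -[X in _ --> X]subr0; exact: cvgB (cvg_cst _) cvgS.
have [z z_prim] := @exists_prim_root C 1 isT (oner_neq0 _).
have cvgV1 : (1 - S x)^-1 @[x --> c] --> (1 : C).
  by rewrite -[X in _ --> X]invr1; exact: cvgV (oner_neq0 _) cvgS1.
pose B (x : 'rV[C]_2) := S x / (1 - S x) ^+ (p + 1).
have cvgB0 : B x @[x --> c] --> (0 : C).
  rewrite (_ : 0 = 0 / 1 ^+ (p + 1)); last by rewrite mul0r.
  have cvgX := @cvgX_complex R _ _ (nbhs_filter c) _ _ (p + 1) cvgS1.
  by apply: cvgM cvgS (cvgV _ cvgX); rewrite expf_neq0 // oner_neq0.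
have cvgx (i : 'I_1) : (1 - S x)^-1 @[x --> c] --> z ^+ i.
  have -> : z ^+ i = 1 by rewrite (ord1 i).
  exact: cvgV1.
have cvg1 : (fun=> 1 : C) @ nbhs c --> (1 : C) by exact: cvg_cst.
(* The general evaluation for q = 1, with g constantly 1, b = s / (1 - s)^(p+1) and the single root
   1 / (1 - s). *)
have nearF := hyperF_q_roots p_gt0 (isT : 0 < 1)%N (nbhs_filter c) a (coprimen1 p) z_prim
  cvg1 cvgB0 cvgx.
have nearK U : nbhs (0 : C) U -> \forall x \near c, U (K * B x).
  move=> U0; have cvgKB : K * B x @[x --> c] --> (0 : C).
    by rewrite -[X in _ --> X](mulr0 K); exact: cvgM (cvg_cst _) cvgB0.
  exact: cvgKB _ U0.
(* (1 - s)^a = ((x_1 - x_0) / x_1)^a as a quotient of two forms of degree |a|; the sign of a decides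
   which is the numerator. *)
have [d [N [D [formN formD Dc NDE]]]] : exists d (N D : 'rV[C]_2 -> C),
    [/\ is_form d N, is_form d D, D c != 0 & forall x : 'rV[C]_2, x 0 1 != 0 -> S x != 1 ->
      N x / D x = (1 - S x) ^ a].
  have SE (x : 'rV[C]_2) : x 0 1 != 0 -> 1 - S x = (x 0 1 - x 0 0) / x 0 1.
    by move=> x1; rewrite mulrBl divff.
  have form01 := is_formB (is_form_coord R (1 : 'I_2)) (is_form_coord R 0).
  case: {nearF} a => m.
    exists (1 * m)%N, (fun x => (x 0 1 - x 0 0) ^+ m), (fun x => x 0 1 ^+ m); split.
    - exact: is_formX.
    - exact/is_formX/is_form_coord.
    - by rewrite c1 expr1n oner_neq0.
    - by move=> x x1 _; rewrite SE // -exprnP exprMn exprVn.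
  exists (1 * m.+1)%N, (fun x => x 0 1 ^+ m.+1), (fun x => (x 0 1 - x 0 0) ^+ m.+1); split.
  - exact/is_formX/is_form_coord.
  - exact: is_formX.
  - by rewrite c1 c0 subr0 expr1n oner_neq0.
  - by move=> x x1 _; rewrite SE // NegzE -exprz_inv -exprnP invfM invrK exprMn exprVn mulrC.
have [[Np NpE] [Dp DpE]] := (formN, formD).
have den_neq0 : exists2 x, @line_s R x & form_eval Dp x != 0 by exists c; rewrite ?DpE.
have BE x w : line_zeta p 1 x w -> [/\ x 0 1 != 0, S x != 1 & w = K * B x].
  by case=> s [x1 -> s1 ->]; split.
exists (RatFun Np den_neq0), c; split => /=.
- move=> s; rewrite inE => /eqP -> x _ /=.
  by rewrite (_ : col_perm 1%g x = x) //; apply/matrixP => i j; rewrite mxE perm1.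
- split; first exact: c_neq0.
  move=> U /nearK nearU; near=> x => w _ /BE[_ _ ->].
  near: x; exact: nearU.
- near=> x => w _ /BE[x1 Sx ->] _.
  rewrite NpE DpE NDE //.
  have S0 : 1 - S x != 0 by rewrite subr_eq0 eq_sym.
  have : ('I_1 -> (1 - S x)^-1 ^+ (p + 1) = 1 * (1 - S x)^-1 ^+ p + B x) ->
      hyperF_q p 1 a%:~R (K * (B x ^+ 1 / 1 ^+ (p + 1))) =
      1^-1 * \sum_(i < 1) ((1 - S x)^-1 ^+ 1 / 1) ^ (- a).
    by near: x.
  rewrite !expr1 expr1n !divr1 invr1 mul1r big_ord1 exprz_inv opprK => ->.
    by rewrite mul1r.
  move=> _; rewrite /B !exprVn addn1 exprS; field.
  by rewrite S0 expf_neq0.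
Unshelve. all: by end_near. Qed.

End OneRoot.

(** * Uniformization of both functions *)

Theorem theorem8p4 (R : realType) (p q : nat)
    (p_gt0 : (0 < p)%N) (q_gt0 : (0 < q)%N) (coprime_pq : coprime p q)
    (a : int) :
  uniformized_by_symm p q q (nbhs (0 : cplx R))
    (fun z : cplx R => hyperF_q p q a%:~R z)
  /\
  uniformized_by_symm p q (p + q) (@nbhs_infty R)
    (fun z : cplx R => hyperF_n p q a%:~R z^-1).
Proof.
split; last exact: uniformized_n.
(* For q = 1 the curve is by convention the line with coordinate s, which calls for a separate
   argument. *)
have [q_gt1|] := ltnP 1 q; first exact: uniformized_q_gt1.
by case: q q_gt0 coprime_pq => [//|[|//]] _ _ _; exact: uniformized_q_eq1.
Qed.
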